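(* Let $d\in\{1,2,3\}$ and $T>0$. Assume: (A1) $E\in\widetilde{\mathbb{R}}$ is a generalized number with positive valuation $\nu_0(E)>0$; (A2) $f\in\mathcal{C}^\infty(\mathbb{R})$ and $f(0)=0$; (A3) $U_0,U_1\in\mathcal{G}^0(\mathbb{R}^d)$ are compactly supported, with supports contained in $B_0=\{x\in\mathbb{R}^d:|x|\le r\}$ for some $r\ge 0$. Let $U\in\mathcal{G}^0([0,T]\times\mathbb{R}^d)$ be the unique solution with support in $K_0=\{(t,x)\in[0,T]\times\mathbb{R}^d:|x|\le t+r\}$ to $$\partial_t^2U-\Delta U=E f(U)\ \text{ in }\ \mathcal{G}^0([0,T]\times\mathbb{R}^d),\qquad U|_{t=0}=U_0,\quad \partial_tU|_{t=0}=U_1\ \text{ in }\ \mathcal{G}^0(\mathbb{R}^d).$$ Let $V\in\mathcal{G}^0([0,T]\times\mathbb{R}^d)$ be the unique solution to the linear problem $$\partial_t^2V-\Delta V=0\ \text{ in }\ \mathcal{G}^0([0,T]\times\mathbb{R}^d),\qquad V|_{t=0}=U_0,\quad \partial_tV|_{t=0}=U_1\ \text{ in }\ \mathcal{G}^0(\mathbb{R}^d).$$ Then $U$ and $V$ are associated.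
   Context: Let $X$ be either a nonempty open subset $\Omega$ of $\mathbb{R}^n$ or the closure $\overline{\Omega}$ of such a set (e.g. $[0,T]\times\mathbb{R}^d$, the closure of $(0,T)\times\mathbb{R}^d$). $\mathcal{C}^\infty(\Omega)$ is the space of real-valued smooth functions on $\Omega$; $\mathcal{C}^\infty(\overline{\Omega})$ is the subspace of those functions all of whose derivatives extend continuously to $\overline{\Omega}$. A net $(u_\varepsilon)_{\varepsilon\in(0,1]}$ in $\mathcal{C}^\infty(X)$ is moderate if for all compact $K\subset X$ and all multi-indices $\alpha$ there is $b\in\mathbb{R}$ with $\sup_{x\in K}|\partial^\alpha u_\varepsilon(x)|=O(\varepsilon^b)$ as $\varepsilon\to0$; it is negligible if for all compact $K\subset X$, all $\alpha$ and all $a\ge0$ one has $\sup_{x\in K}|\partial^\alpha u_\varepsilon(x)|=O(\varepsilon^a)$ as $\varepsilon\to 0$. The Colombeau algebra is $\mathcal{G}(X)=\mathcal{E}_M(X)/\mathcal{N}(X)$, the moderate nets modulo the negligible nets, with operations (sum, product, derivatives, restriction, e.g. to $t=0$) defined on representatives. $\mathcal{G}^0(X)$ is the subalgebra of those $U\in\mathcal{G}(X)$ all of whose derivatives are of bounded type on compact sets, i.e. having a representative with $\sup_{x\in K}|\partial^\alpha u_\varepsilon(x)|=O(1)$ as $\varepsilon\to0$ for every compact $K\subset X$ and every $\alpha$. For $f\in\mathcal{C}^\infty(\mathbb{R})$ and $U\in\mathcal{G}^0(X)$ with representative $(u_\varepsilon)$, $f(U)\in\mathcal{G}^0(X)$ is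 the class of $(f(u_\varepsilon))$, which is well defined. The support of $U\in\mathcal{G}(X)$ is the complement in $X$ of the largest (relatively) open subset $\omega$ of $X$ with $U|_\omega=0$. The ring $\widetilde{\mathbb{R}}$ of generalized numbers is the set of nets $(e_\varepsilon)_{\varepsilon\in(0,1]}$ of real numbers with $|e_\varepsilon|=O(\varepsilon^b)$ for some $b\in\mathbb{R}$, modulo nets that are $O(\varepsilon^a)$ for every $a\ge0$. For $E\in\widetilde{\mathbb{R}}$ with representative $(e_\varepsilon)$, $\nu_0(E)=\sup\{b\in\mathbb{R}:|e_\varepsilon|=O(\varepsilon^b)\text{ as }\varepsilon\to0\}$. $\Delta$ is the Laplacian in $x\in\mathbb{R}^d$. Two elements $U,V\in\mathcal{G}([0,T]\times\mathbb{R}^d)$ with representatives $(u_\varepsilon)$, $(v_\varepsilon)$ are associated if $\lim_{\varepsilon\to0}\int_0^T\int_{\mathbb{R}^d}(u_\varepsilon(t,x)-v_\varepsilon(t,x))\psi(t,x)\,dx\,dt=0$ for every compactly supported $\psi\in\mathcal{C}^\infty([0,T]\times\mathbb{R}^d)$. Under (A1)–(A3) both solutions $U$ (unique in $\mathcal{G}^0([0,T]\times\mathbb{R}^d)$ among elements with support in $K_0$) and $V$ exist and are unique. *)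

(* Defs.v *)
From HB Require Import structures.
From mathcomp Require Import all_boot all_order all_algebra.
From mathcomp Require Import generic_quotient ring_quotient.
From mathcomp Require Import ring lra.
From mathcomp Require Import all_classical all_reals all_analysis.

Set Implicit Arguments.
Unset Strict Implicit.
Unset Printing Implicit Defensive.

Import Order.TTheory GRing.Theory Num.Theory.
Import numFieldNormedType.Exports.

Local Open Scope classical_set_scope.
Local Open Scope ring_scope.
Local Open Scope quotient_scope.

(* A set X lying between an open set and its closure: this covers a nonempty
   open set Om (X = Om), its closure (X = closure Om), and the relatively open
   subsets of both, to which generalized functions are restricted. *)
Record domain (R : realType) (n : nat) := Domain {
  inner : set 'rV[R]_n;
  carrier :> set 'rV[R]_n;
  inner_open : open inner;
  inner_sub : inner `<=` carrier;
  carrier_sub : carrier `<=` closure inner }.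

Definition partial (R : realType) n (i : 'I_n) (f : 'rV[R]_n -> R) :
  'rV[R]_n -> R := 'D_(delta_mx 0 i) f.

(* A multi-index is given by the list of its directions, with repetitions:
   partials [:: i1; ...; ik] f is the derivative d_i1 ... d_ik f.  On smooth
   functions the order of the list is immaterial. *)
Definition partials (R : realType) n (s : seq 'I_n) (f : 'rV[R]_n -> R) :
  'rV[R]_n -> R := foldr (@partial R n) f s.

(* The continuous extension to X of a function on the inner open set. *)
Definition ext (R : realType) n (X : domain R n) (g : 'rV[R]_n -> R) :
  'rV[R]_n -> R := fun x => lim (g @ within (inner X) (nbhs x)).

(* C^oo(X).  Functions are total and only their values on X matter; on X a
   function coincides with its own extension, by the first clause. *)
Definition smooth (R : realType) n (X : domain R n) (f : 'rV[R]_n -> R) :=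
  {within X, continuous f} /\
  forall s : seq 'I_n,
    (forall i x, inner X x -> derivable (partials s f) x (delta_mx 0 i)) /\
    exists2 g : 'rV[R]_n -> R,
      {within X, continuous g} & forall x, inner X x -> g x = partials s f x.

Notation net R n := (R -> 'rV[R]_n -> R).

Definition smooth_net (R : realType) n (X : domain R n) (u : net R n) :=
  forall eps : R, 0 < eps <= 1 -> smooth X (u eps).

Definition seminorm (R : realType) n (X : domain R n) (K : set 'rV[R]_n)
    (s : seq 'I_n) (u : net R n) : R -> R :=
  fun eps => sup [set `|ext X (partials s (u eps)) x| | x in K].

Definition moderate (R : realType) n (X : domain R n) (u : net R n) :=
  smooth_net X u /\
  forall K s, compact K -> K `<=` X ->
    exists b : R, seminorm X K s u =O_ (0^'+) (fun eps : R => eps `^ b).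

Definition negligible (R : realType) n (X : domain R n) (u : net R n) :=
  smooth_net X u /\
  forall K s, compact K -> K `<=` X -> forall a : R, 0 <= a ->
    seminorm X K s u =O_ (0^'+) (fun eps : R => eps `^ a).

Definition bounded_type (R : realType) n (X : domain R n) (u : net R n) :=
  smooth_net X u /\
  forall K s, compact K -> K `<=` X ->
    seminorm X K s u =O_ (0^'+) (fun=> 1 : R).

Definition negl (R : realType) n (X : domain R n) : {pred net R n} :=
  [pred u | `[< negligible X u >]].

Section NegligibleZmod.
Variables (R : realType) (n : nat) (X : domain R n).
Implicit Types (f g : 'rV[R]_n -> R) (u v : net R n).

Lemma inner_near x : inner X x -> \forall y \near x, inner X y.
Proof. by move=> Xx; apply: open_nbhs_nbhs; split=> //; exact: inner_open. Qed.

Lemma partials0 s : partials s (0 : 'rV[R]_n -> R) = 0.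
Proof.
elim: s => [//|i s IHs] /=; rewrite /partials /= -/(partials s 0) IHs.
by apply/funext => x; rewrite /partial derive_cst.
Qed.

Lemma partialsB f g s x : smooth X f -> smooth X g -> inner X x ->
  partials s (f - g) x = partials s f x - partials s g x.
Proof.
move=> [_ sf] [_ sg]; elim: s x => [//|i s IHs] x Xx.
rewrite /partials /= -!/(partials s _) /partial.
rewrite -(deriveB (proj1 (sf s) i x Xx) (proj1 (sg s) i x Xx)).
apply: near_eq_derive; have := inner_near Xx.
by apply: filterS => y; exact: IHs.
Qed.

Lemma extE f g x : {within X, continuous g} ->
  (forall y, inner X y -> g y = f y) -> carrier X x -> ext X f x = g x.
Proof.
move=> /subspace_continuousP cg gf Xx.
have PF : ProperFilter (within (inner X) (nbhs x)).
  exact: (within_nbhs_proper (carrier_sub Xx)).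
apply: cvg_lim => //; have {cg} := cg x Xx.
move=> cg A /cg; rewrite !nbhs_simpl /= /within /= => nA.
apply: filterS nA => y XA Xy; rewrite -gf//; apply: XA.
exact: inner_sub.
Qed.

Lemma smooth0 : smooth X 0.
Proof.
split=> [|s]; first exact: (continuous_subspaceT (@cst_continuous _ _ 0)).
rewrite partials0; split=> [i x _|]; first exact: derivable_cst.
by exists 0 => //; exact: (continuous_subspaceT (@cst_continuous _ _ 0)).
Qed.

Lemma smoothB f g : smooth X f -> smooth X g -> smooth X (f - g).
Proof.
move=> sf sg; have [[cf sf'] [cg sg']] := (sf, sg).
split=> [|s]; first exact: within_continuousB.
split=> [i x Xx|].
  apply: (@near_eq_derivable _ _ _ (partials s f - partials s g)).
    by apply: filterS (inner_near Xx) => y Xy; rewrite partialsB.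
  exact: derivableB (proj1 (sf' s) i x Xx) (proj1 (sg' s) i x Xx).
have [[_ [f' cf' ff']] [_ [g' cg' gg']]] := (sf' s, sg' s).
exists (f' - g'); first exact: within_continuousB.
by move=> x Xx; rewrite partialsB// -ff'// -gg'.
Qed.

Lemma extB f g s x : smooth X f -> smooth X g -> carrier X x ->
  ext X (partials s (f - g)) x =
  ext X (partials s f) x - ext X (partials s g) x.
Proof.
move=> sf sg Xx; have [_ /(_ s)[_ [f' cf' ff']]] := sf.
have [_ /(_ s)[_ [g' cg' gg']]] := sg.
rewrite (extE cf' ff' Xx) (extE cg' gg' Xx).
apply: (@extE _ (f' - g')) Xx; first exact: within_continuousB.
by move=> y Xy; rewrite partialsB// -ff'// -gg'.
Qed.

Lemma ext_has_ubound K s f : smooth X f -> compact K -> K `<=` X ->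
  has_ubound [set `|ext X (partials s f) x| | x in K].
Proof.
move=> [_ /(_ s)[_ [g cg gf]]] cK KX.
have /compact_bounded[M [_ MP]] : compact (g @` K).
  by apply: continuous_compact => //; exact: continuous_subspaceW cg.
exists (M + 1) => _ [x Kx <-]; rewrite (extE cg gf (KX _ Kx)).
by apply: MP; [rewrite ltrDl | exists x].
Qed.

Lemma sup_norm_ge0 (A : Type) (K : set A) (h : A -> R) :
  0 <= sup [set `|h x| | x in K].
Proof.
have [ub|nub] := pselect (has_ubound [set `|h x| | x in K]); last first.
  by rewrite sup_out// => -[].
have [->|/set0P[x Kx]] := eqVneq K set0; first by rewrite image_set0 sup0.
by apply: (@le_trans _ _ `|h x|) => //; apply: ub_le_sup => //; exists x.
Qed.

Lemma seminormB K s u v eps : smooth X (u eps) -> smooth X (v eps) ->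
  compact K -> K `<=` X ->
  seminorm X K s (u - v) eps <= seminorm X K s u eps + seminorm X K s v eps.
Proof.
move=> su sv cK KX; rewrite /seminorm.
have [K0|/set0P[x0 Kx0]] := eqVneq K set0.
  by rewrite K0 !image_set0 !sup0 addr0.
apply: ge_sup; first by exists `|ext X (partials s ((u - v) eps)) x0|; exists x0.
move=> _ [x Kx <-]; rewrite extB//; last exact: KX.
apply: le_trans (ler_normB _ _) _.
by apply: lerD; apply: ub_le_sup; [exact: ext_has_ubound|exists x|
  exact: ext_has_ubound|exists x].
Qed.

Lemma negl_zmod_closed : zmod_closed (negl X).
Proof.
split=> [|u v /asboolP[su nu] /asboolP[sv nv]]; apply/asboolP.
  split=> [eps _|K s cK KX a a0]; first exact: smooth0.
  apply/eqOP; near=> k; near=> eps.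
  have -> : seminorm X K s 0 eps = 0.
    rewrite /seminorm; have [->|/set0P[x Kx]] := eqVneq K set0.
      by rewrite image_set0 sup0.
    suff -> : [set `|ext X (partials s (0 : 'rV[R]_n -> R)) x| | x in K] = [set 0].
      by rewrite sup1.
    apply/seteqP; split=> [_ [y Ky <-]/=|_ ->/=].
      rewrite partials0 (@extE _ 0) ?normr0//; last exact: KX.
      exact: (continuous_subspaceT (@cst_continuous _ _ 0)).
    exists x => //; rewrite partials0 (@extE _ 0) ?normr0//; last exact: KX.
    exact: (continuous_subspaceT (@cst_continuous _ _ 0)).
  by rewrite normr0 mulr_ge0.
split=> [eps e01|K s cK KX a a0]; first by apply: smoothB; [exact: su|exact: sv].
have /eqO_exP[k1 k10 h1] := nu K s cK KX a a0.
have /eqO_exP[k2 k20 h2] := nv K s cK KX a a0.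
apply/eqO_exP; exists (k1 + k2); first exact: addr_gt0.
near=> eps.
have e01 : 0 < eps <= 1.
  by apply/andP; split; near: eps; [exact: nbhs_right_gt|exact: nbhs_right_le].
rewrite ger0_norm ?sup_norm_ge0//.
apply: le_trans (seminormB s (su _ e01) (sv _ e01) cK KX) _.
rewrite mulrDl; apply: lerD; apply: le_trans (ler_norm _) _; near: eps.
  exact: h1.
exact: h2.
Unshelve. all: by end_near. Qed.

HB.instance Definition _ :=
  GRing.isZmodClosed.Build (net R n) (negl X) negl_zmod_closed.

End NegligibleZmod.

(* All nets modulo the negligible ones.  The Colombeau algebra
   G(X) = E_M(X) / N(X) is the subset formed by the classes of the moderate
   nets; every representative of such a class is moderate. *)
Definition gen_fun (R : realType) n (X : domain R n) : zmodType :=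
  Quotient.quot (negl X).

Definition gclass (R : realType) n (X : domain R n) (u : net R n) : gen_fun X :=
  \pi_(Quotient.quot (negl X)) u.

Definition grepr (R : realType) n (X : domain R n) (U : gen_fun X) : net R n :=
  repr (U : Quotient.quot (negl X)).

Lemma gclassP (R : realType) n (X : domain R n) (u v : net R n) :
  gclass X u = gclass X v <-> negligible X (u - v).
Proof.
rewrite /gclass; split=> [/eqP|uv]; last apply/eqP; rewrite -Quotient.idealrBE.
  by move/asboolP.
exact/asboolP.
Qed.

Lemma gclassB (R : realType) n (X : domain R n) :
  {morph gclass X : u v / u - v}.
Proof. by move=> u v; rewrite /gclass !piE. Qed.

Lemma greprK (R : realType) n (X : domain R n) : cancel (@grepr R n X) (gclass X).
Proof. exact: reprK. Qed.

Definition colombeau (R : realType) n (X : domain R n) : set (gen_fun X) :=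
  [set U | exists2 u, moderate X u & gclass X u = U].

Definition colombeau0 (R : realType) n (X : domain R n) : set (gen_fun X) :=
  [set U | colombeau U /\ exists2 u, bounded_type X u & gclass X u = U].

(* Operations defined on representatives.  A derivative is extended from the
   inner open set to X, so that it can be evaluated on the boundary. *)
Definition gpartial (R : realType) n (X : domain R n) (i : 'I_n)
    (U : gen_fun X) : gen_fun X :=
  gclass X (fun eps => ext X (partial i (grepr U eps))).

Definition gcomp (R : realType) n (X : domain R n) (f : R -> R)
    (U : gen_fun X) : gen_fun X :=
  gclass X (fun eps x => f (grepr U eps x)).

Section Restriction.
Variables (R : realType) (n : nat) (X : domain R n) (O : set 'rV[R]_n).
Hypothesis oO : open O.

Lemma restr_open : open (inner X `&` O).
Proof. by apply: openI => //; exact: inner_open. Qed.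

Lemma restr_sub : inner X `&` O `<=` carrier X `&` O.
Proof. by apply: setSI; exact: inner_sub. Qed.

Lemma restr_closure : carrier X `&` O `<=` closure (inner X `&` O).
Proof.
move=> x [Xx Ox] B nB.
have [y [Xy [Oy By]]] : inner X `&` (O `&` B) !=set0.
  apply: (carrier_sub Xx); apply: filterI => //.
  exact: open_nbhs_nbhs.
by exists y.
Qed.

Definition restr_domain : domain R n :=
  Domain restr_open restr_sub restr_closure.

Definition grestr (U : gen_fun X) : gen_fun restr_domain :=
  gclass restr_domain (grepr U).

End Restriction.

Definition gsupport (R : realType) n (X : domain R n) (U : gen_fun X) :
  set 'rV[R]_n :=
  X `\` \bigcup_(O in [set O | exists oO : open O, grestr oO U = 0]) O.

Definition neglR (R : realType) : {pred R -> R} :=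
  [pred e | `[< forall a : R, 0 <= a ->
                  e =O_ (0^'+) (fun eps : R => eps `^ a) >]].

Lemma neglR_zmod_closed (R : realType) : zmod_closed (@neglR R).
Proof.
split=> [|e1 e2 /asboolP h1 /asboolP h2]; apply/asboolP => a a0.
  by apply/eqO_exP; exists 1 => //; near=> eps; rewrite normr0 mul1r.
have /eqO_exP[k1 k10 {}h1] := h1 a a0; have /eqO_exP[k2 k20 {}h2] := h2 a a0.
apply/eqO_exP; exists (k1 + k2); first exact: addr_gt0.
near=> eps; rewrite mulrDl; apply: le_trans (ler_normB _ _) _.
by apply: lerD; near: eps.
Unshelve. all: by end_near. Qed.

HB.instance Definition _ (R : realType) :=
  GRing.isZmodClosed.Build (R -> R) (@neglR R) (@neglR_zmod_closed R).

Definition gen_num (R : realType) : zmodType := Quotient.quot (@neglR R).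

Definition nclass (R : realType) (e : R -> R) : gen_num R :=
  \pi_(Quotient.quot (@neglR R)) e.

Definition nrepr (R : realType) (E : gen_num R) : R -> R :=
  repr (E : Quotient.quot (@neglR R)).

(* The ring of generalized numbers, as a subset of all nets of real numbers
   modulo the negligible ones. *)
Definition generalized_number (R : realType) : set (gen_num R) :=
  [set E | exists2 e : R -> R,
    exists b : R, e =O_ (0^'+) (fun eps : R => eps `^ b) & nclass e = E].

Definition valuation (R : realType) (E : gen_num R) : \bar R :=
  ereal_sup [set b%:E | b in
    [set b : R | nrepr E =O_ (0^'+) (fun eps : R => eps `^ b)]].

Definition gscale (R : realType) n (X : domain R n) (E : gen_num R)
    (U : gen_fun X) : gen_fun X :=
  gclass X (fun eps x => nrepr E eps * grepr U eps x).

Definition enorm (R : realType) d (x : 'rV[R]_d) : R :=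
  Num.sqrt (\sum_(i < d) x 0 i ^+ 2).

Section Spaces.
Variables (R : realType) (d : nat).

Lemma whole_closure : [set: 'rV[R]_d] `<=` closure [set: 'rV[R]_d].
Proof. exact: subset_closure. Qed.

Definition whole : domain R d :=
  Domain openT (@subset_refl _ [set: 'rV[R]_d]) whole_closure.

(* R^(1+d) is space-time, with time as the first coordinate. *)
Definition tdir : 'I_(1 + d) := lshift d ord0.
Definition sdir (j : 'I_d) : 'I_(1 + d) := rshift 1 j.
Definition point (t : R) (x : 'rV[R]_d) : 'rV[R]_(1 + d) := row_mx t%:M x.
Definition time_of (z : 'rV[R]_(1 + d)) : R := z 0 tdir.
Definition space_of (z : 'rV[R]_(1 + d)) : 'rV[R]_d := rsubmx z.

Variable T : R.

Definition open_slab : set 'rV[R]_(1 + d) := [set z | 0 < time_of z < T].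
Definition closed_slab : set 'rV[R]_(1 + d) := [set z | 0 <= time_of z <= T].

Lemma slab_open : open open_slab.
Proof.
have -> : open_slab = time_of @^-1` `]0, T[%classic.
  by apply/seteqP; split=> z; rewrite /open_slab /= in_itv.
apply: open_comp => [z _|]; first exact: coord_continuous.
exact: interval_open.
Qed.

Lemma slab_sub : open_slab `<=` closed_slab.
Proof. by move=> z /andP[z0 zT]; rewrite /closed_slab /= !ltW. Qed.

Hypothesis T_gt0 : 0 < T.

Lemma slab_closure : closed_slab `<=` closure open_slab.
Proof.
move=> z /andP[z0 zT] B nB.
pose m : R := T / 2 - time_of z.
pose l (s : R) : 'rV[R]_(1 + d) := z + s *: (m *: delta_mx 0 tdir).
have timel s : time_of (l s) = time_of z + s * m.
  by rewrite /time_of /l !mxE !eqxx /= mulr1.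
have cl : l s @[s --> 0^'+] --> z.
  rewrite -[X in _ --> X](_ : l 0 = z); last by rewrite /l scale0r addr0.
  apply: cvg_at_right_filter; apply: cvgD; first exact: cvg_cst.
  by apply: cvgZr_tmp; exact: cvg_id.
near (0 : R)^'+ => s.
have s0 : 0 < s by near: s; exact: nbhs_right_gt.
have s1 : s < 1 by near: s; exact: nbhs_right_lt.
exists (l s); split; last by near: s; exact: cl.
rewrite /open_slab /= timel /m; apply/andP; split.
  suff : 0 < (1 - s) * time_of z + s * (T / 2) by congr (0 < _); lra.
  by apply: ltr_wpDl; [apply: mulr_ge0 => //; lra | exact: mulr_gt0 s0 (divr_gt0 T_gt0 _)].
rewrite -subr_gt0.
suff : 0 < (1 - s) * (T - time_of z) + s * (T / 2) by congr (0 < _); lra.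
by apply: ltr_wpDl; [apply: mulr_ge0; lra | exact: mulr_gt0 s0 (divr_gt0 T_gt0 _)].
Unshelve. all: by end_near. Qed.

Definition slab : domain R (1 + d) := Domain slab_open slab_sub slab_closure.

Definition dalembertian (U : gen_fun slab) : gen_fun slab :=
  gpartial tdir (gpartial tdir U) -
  \sum_(j < d) gpartial (sdir j) (gpartial (sdir j) U).

Definition initial (U : gen_fun slab) : gen_fun whole :=
  gclass whole (fun eps x => grepr U eps (point 0 x)).

End Spaces.

Fixpoint space_integral (R : realType) (d : nat) : ('rV[R]_d -> R) -> R :=
  match d with
  | 0 => fun g => g 0
  | d'.+1 => fun g =>
      \int[@lebesgue_measure R]_s
        space_integral (fun x : 'rV[R]_d' => g (row_mx s%:M x))
  end.

Definition associated (R : realType) d (T : R) (T_gt0 : 0 < T)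
    (U V : gen_fun (slab d T_gt0)) : Prop :=
  forall u v, gclass _ u = U -> gclass _ v = V ->
  forall psi : 'rV[R]_(1 + d) -> R, smooth (slab d T_gt0) psi ->
    compact (closure [set z | closed_slab T z /\ psi z != 0]) ->
    (\int[@lebesgue_measure R]_(t in `[0, T])
       space_integral (fun x : 'rV[R]_d =>
         (u eps (point t x) - v eps (point t x)) * psi (point t x)))
      @[eps --> 0^'+] --> 0.

(* Main.v *)
From Pilot Require Import Defs.
From mathcomp Require Import all_boot all_order all_algebra.
From mathcomp Require Import ring lra.
From mathcomp Require Import all_classical all_reals all_analysis.
From mathcomp Require Import measurable_realfun.

(* Let w = u - v for representatives of U and V. Both are of bounded type, so
   all derivatives of w are bounded on compact sets uniformly in epsilon, while
   the wave operator applied to w and the Cauchy data of w tend to 0 uniformly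
   on compact sets, since f(u) is bounded there and the valuation of E is
   positive. With the cutoff chi = max((A - t)^2 - |x|^2, 0)^2, whose gradient
   is dominated by - d_t chi, the energy int chi (w_t^2 + |grad w|^2) dx grows
   at most at the rate int 2 chi w_t (w_tt - Delta w) dx, so it tends to 0. The
   uniform Lipschitz bound on w_t turns this into uniform convergence of w_t,
   hence of w, to 0 on compact sets, which gives association. *)

Set Implicit Arguments.
Unset Strict Implicit.
Unset Printing Implicit Defensive.

Import Order.TTheory GRing.Theory Num.Theory.
Import numFieldNormedType.Exports.
(* [all_classical] shadows [Defs.point]. *)
Import Pilot.Defs.

Local Open Scope classical_set_scope.
Local Open Scope ring_scope.

(** * Integral bounds *)

(** Smooth functions on the closed slab are required to be differentiable only in its interior, with
    derivatives that extend continuously to the boundary. The wave equation is therefore used at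
    times in the open interval, and the energy inequality starts at some [s > 0]. In the layer
    [0 < s <= eta] the energy is estimated directly: the Cauchy data bound [w] and [w_t] there by a
    multiple of [eta], but a small [w] alone says nothing about its gradient, which is interpolated
    between [w] and the bounded second derivatives at the price of a square root of [eta].

    The positive part in the cutoff is squared to make its first derivatives continuous. The cutoff
    vanishes near the faces of a fixed box, so all energies are iterated one-variable integrals over
    that box and integration by parts leaves no boundary term.

    The analytic core concerns a single function: bounds [M] and errors [eta] go in, a bound [delta]
    comes out. The parameter epsilon enters only through representatives: those chosen for
    derivatives, for f(U) and for initial values differ from the expected nets by negligible ones,
    and these discrepancies are absorbed into [eta]. *)

Section RintegralBound.
Context disp {T : measurableType disp} {R : realType}.
Variable mu : {measure set T -> \bar R}.
Import HBNNSimple.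

(** The integral of a nonnegative function is a supremum over the simple functions below it. Each of
    these lies below the step function equal to [C] on [B] and to 0 elsewhere, so monotonicity is
    applied to measurable functions only. *)
Lemma integral_le_bound (D B : set T) (f : T -> \bar R) (C : R) :
  measurable B -> 0 <= C -> (forall x, D x -> (0 <= f x)%E) ->
  (forall x, D x -> B x -> (f x <= C%:E)%E) ->
  (forall x, D x -> ~ B x -> f x = 0%E) ->
  (\int[mu]_(x in D) f x <= C%:E * mu B)%E.
Proof.
move=> mB C0 f_ge0 fC fB; rewrite ge0_integralE//.
apply: ge_ereal_sup => _ [h /= hf <-].
have -> : sintegral mu h = (\int[mu]_x (h x)%:E)%E.
  by rewrite integral_nnsfun// patch_setT.
rewrite -integral_cst//= [leRHS]integral_mkcond.
apply: ge0_le_integral => //.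
- by move=> x _; rewrite lee_fin; exact: fun_ge0.
- exact/measurable_EFinP.
- by apply/(measurable_restrictT _ mB)/measurable_cst.
move=> x _; apply: le_trans (hf x) _; rewrite /patch.
case: ifPn => xD; case: ifPn => xB //.
- by apply: fC; exact: set_mem.
- rewrite fB//; first exact: set_mem.
  by move=> /mem_set; exact/negP.
Qed.

(* No measurability of [f] is assumed: the integral is by definition the
   difference of two suprema over simple functions. *)
Lemma normr_Rintegral_le (D B : set T) (f : T -> R) (C : R) :
  measurable B -> (mu B < +oo)%E -> 0 <= C ->
  (forall x, D x -> B x -> `|f x| <= C) ->
  (forall x, D x -> ~ B x -> f x = 0) ->
  `|\int[mu]_(x in D) f x| <= C * fine (mu B).
Proof.
move=> mB Bfin C0 fC fB; rewrite /Rintegral integralE.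
set P := (\int[mu]_(x in D) _)%E; set N := (\int[mu]_(x in D) _)%E.
have muBf : mu B \is a fin_num by rewrite ge0_fin_numE.
have CE : (C%:E * mu B = (C * fine (mu B))%:E)%E by rewrite EFinM fineK.
have P0 : (0 <= P)%E by exact: integral_ge0.
have N0 : (0 <= N)%E by exact: integral_ge0.
have PC : (P <= C%:E * mu B)%E.
  apply: integral_le_bound => // x Dx Bx.
    rewrite funeposE -EFin_max lee_fin ge_max C0 andbT.
    exact: le_trans (ler_norm _) (fC _ Dx Bx).
  by rewrite funeposE fB// maxxx.
have NC : (N <= C%:E * mu B)%E.
  apply: integral_le_bound => // x Dx Bx.
    rewrite funenegE -EFinN -EFin_max lee_fin ge_max C0 andbT.
    by apply: le_trans (ler_norm _) _; rewrite normrN; exact: fC.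
  by rewrite funenegE fB// oppe0 maxxx.
move: P0 N0 PC NC; rewrite CE; move: P N => [p| |] [q| |] //=.
rewrite !lee_fin => p0 q0 pC qC; rewrite ler_norml; apply/andP; split; lra.
Qed.

End RintegralBound.

Section Interval.
Variable R : realType.

Lemma fine_lebesgue_itvcc (a b : R) : a <= b ->
  fine (@lebesgue_measure R `[a, b]%classic) = b - a.
Proof.
rewrite le_eqVlt lebesgue_measure_itv/= lte_fin => /predU1P[->|->//].
by rewrite ltxx subrr.
Qed.

Lemma lebesgue_itvcc_fin (a b : R) :
  (@lebesgue_measure R `[a, b]%classic < +oo)%E.
Proof.
by rewrite lebesgue_measure_itv/=; case: ifP => _; rewrite ?ltry// -EFinB ltry.
Qed.

Lemma continuous_itv_integrable (f : R -> R) (a b : R) : continuous f ->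
  (@lebesgue_measure R).-integrable `[a, b]%classic (EFin \o f).
Proof.
move=> cf; apply: continuous_compact_integrable; first exact: segment_compact.
exact: continuous_subspaceT.
Qed.

End Interval.

(** * Space-time coordinates *)

Section AlongLines.
Variables (R : realType) (V W : normedModType R).

(** A directional derivative only sees the function along one line. When [phi] maps the line through
    [a] to the line through [phi a], the two difference quotients are the same function of [h]. Time
    lines, space slices, translations and coordinates are all instances. *)
Lemma is_derive_affine (f : W -> R) (phi : V -> W) (a v : V) (w : W) (df : R) :
  (forall h : R, phi (h *: v + a) = h *: w + phi a) ->
  is_derive (phi a) w f df <-> is_derive a v (f \o phi) df.
Proof.
move=> phiE; have growthE : (fun h : R =>
    h^-1 *: (((f \o phi) \o shift a) (h *: v) - (f \o phi) a)) =
    (fun h : R => h^-1 *: ((f \o shift (phi a)) (h *: w) - f (phi a))).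
  by apply/funext => h /=; rewrite phiE.
split=> -[df1 df2]; split.
- by rewrite /derivable growthE.
- by rewrite /derive growthE.
- by rewrite /derivable -growthE.
- by rewrite /derive -growthE.
Qed.

End AlongLines.

Lemma continuous_row (R : realType) (T : topologicalType) n
    (phi : T -> 'rV[R]_n) (a : T) :
  (forall j, {for a, continuous (fun y => phi y 0 j)}) ->
  {for a, continuous phi}.
Proof.
move=> phic; apply/cvg_ballP => e e0.
have : \forall y \near a, forall j, ball (phi a 0 j) e (phi y 0 j).
  by apply: filter_forall => j; have /cvg_ballP := phic j; exact.
by apply: filterS => y aey; split=> // i j; rewrite !ord1; exact: aey.
Qed.

Section Points.
Variables (R : realType) (d : nat).
Implicit Types (t : R) (x : 'rV[R]_d) (z : 'rV[R]_(1 + d)).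

Lemma time_of_point t x : time_of (point t x) = t.
Proof. by rewrite /time_of /point /tdir row_mxEl mxE eqxx. Qed.

Lemma space_of_point t x : space_of (point t x) = x.
Proof. exact: row_mxKr. Qed.

Lemma point_sdir t x j : point t x 0 (sdir j) = x 0 j.
Proof. exact: row_mxEr. Qed.

Lemma space_ofE z j : space_of z 0 j = z 0 (sdir j).
Proof. by rewrite /space_of mxE. Qed.

Lemma pointK z : point (time_of z) (space_of z) = z.
Proof.
rewrite /point /space_of -[RHS]hsubmxK; congr row_mx.
by apply/rowP => i; rewrite !ord1 !mxE eqxx.
Qed.

Lemma point_time_line t x (h : R) :
  point (h *: 1 + t) x = h *: delta_mx 0 (tdir d) + point t x.
Proof.
rewrite /point; apply/rowP => i; case: (split_ordP i) => j ->.
  by rewrite row_mxEl [RHS]mxE row_mxEl !mxE !ord1 !eqxx /= -[h%:A]/(h * 1) !mulr1.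
by rewrite row_mxEr [RHS]mxE row_mxEr !mxE /tdir eq_rlshift andbF mulr0 add0r.
Qed.

Lemma point_space_line t x j (h : R) :
  point t (h *: delta_mx 0 j + x) = h *: delta_mx 0 (sdir j) + point t x.
Proof.
rewrite /point; apply/rowP => i; case: (split_ordP i) => k ->.
  by rewrite row_mxEl [RHS]mxE row_mxEl !mxE /sdir eq_lrshift andbF mulr0 add0r.
by rewrite row_mxEr [RHS]mxE row_mxEr !mxE /sdir eq_rshift.
Qed.

Lemma continuous_point (T : topologicalType) (t : T -> R) (x : T -> 'rV[R]_d) a :
  {for a, continuous t} -> {for a, continuous x} ->
  {for a, continuous (fun y => point (t y) (x y))}.
Proof.
move=> tc xc; apply: continuous_row => i.
case: (split_ordP i) => j ->.
  rewrite [X in {for _, continuous X}](_ : _ = t) //.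
  by apply/funext => y; rewrite row_mxEl ord1 mxE eqxx.
rewrite [X in {for _, continuous X}](_ : _ = (fun y => x y 0 j)).
  by apply: (@continuous_comp _ _ _ x (fun x : 'rV_d => x 0 j)) => //;
    exact: coord_continuous.
by apply/funext => y; rewrite row_mxEr.
Qed.

Lemma continuous_time_of : continuous (@time_of R d).
Proof. exact: coord_continuous. Qed.

Lemma continuous_space_of : continuous (@space_of R d).
Proof.
move=> z; apply: continuous_row => j.
rewrite [X in {for _, continuous X}](_ : _ = (fun z => z 0 (sdir j))).
  exact: coord_continuous.
by apply/funext => y; rewrite space_ofE.
Qed.

Lemma is_derive_time (G : 'rV[R]_(1 + d) -> R) t x g' :
  is_derive (point t x) (delta_mx 0 (tdir d)) G g' ->
  is_derive t 1 (fun s => G (point s x)) g'.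
Proof.
exact: (@is_derive_affine R R^o _ G (fun s => point s x) t 1 _ g'
  (point_time_line t x)).1.
Qed.

Lemma is_derive_space (G : 'rV[R]_(1 + d) -> R) t x j g' :
  is_derive (point t x) (delta_mx 0 (sdir j)) G g' ->
  is_derive x (delta_mx 0 j) (fun y => G (point t y)) g'.
Proof.
exact: (@is_derive_affine R _ _ G (fun y => point t y) x (delta_mx 0 j) _ g'
  (point_space_line t x j)).1.
Qed.

End Points.

(** * Iterated integrals over a box *)

Section BoxIntegral.
Variables (R : realType) (L : R).
Hypothesis L_gt0 : 0 < L.

Local Notation mu := (@lebesgue_measure R).

(** Same recursion as [space_integral], with every variable confined to a segment, so that
    continuous integrands are integrable at each stage. The order of the variables is fixed once and
    for all and Fubini's theorem is never invoked. *)
Fixpoint box_integral (d : nat) : ('rV[R]_d -> R) -> R :=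
  match d with
  | 0 => fun g => g 0
  | d'.+1 => fun g =>
      \int[mu]_(s in `[(- L), L]) box_integral (fun x : 'rV[R]_d' => g (point s x))
  end.

Definition box d : set 'rV[R]_d := [set x | forall j, `|x 0 j| <= L].

Lemma box_point d s (x : 'rV[R]_d) : `[(- L), L]%classic s -> box x ->
  box (point s x : 'rV[R]_(1 + d)).
Proof.
rewrite /= in_itv /= => sL xL j; case: (split_ordP j) => k ->.
  by rewrite row_mxEl ord1 mxE eqxx mulr1n ler_norml.
by rewrite row_mxEr; exact: xL.
Qed.

Lemma box_integral_cst d c : @box_integral d (fun=> c) = c * (2 * L) ^+ d.
Proof.
elim: d => [|d IHd] /=; first by rewrite expr0 mulr1.
have L0 := L_gt0; rewrite IHd Rintegral_cst//= fine_lebesgue_itvcc; last by lra.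
by rewrite exprSr -mulrA; congr (_ * (_ * _)); lra.
Qed.

Lemma box_integral_bound d (g : 'rV[R]_d -> R) C :
  0 <= C -> (forall x, box x -> `|g x| <= C) ->
  `|box_integral g| <= C * (2 * L) ^+ d.
Proof.
move=> C0; have L0 := L_gt0; elim: d g => [|d IHd] g gC /=.
  by rewrite expr0 mulr1; apply: gC => -[].
have -> : C * (2 * L) ^+ d.+1 = C * (2 * L) ^+ d * fine (mu `[(- L), L]%classic).
  by rewrite fine_lebesgue_itvcc ?exprSr ?mulrA; lra.
apply: normr_Rintegral_le => //; first exact: lebesgue_itvcc_fin.
  by apply: mulr_ge0 => //; apply: exprn_ge0; lra.
by move=> s sL _; apply: IHd => x xL; apply: gC; exact: box_point.
Qed.

Lemma cylinder_compact d (a b : R) :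
  compact [set z : 'rV[R]_(1 + d) | a <= time_of z <= b /\ box (space_of z)].
Proof.
pose A (i : 'I_(1 + d)) : set R :=
  match fintype.split i with inl _ => `[a, b] | inr _ => `[(- L), L] end%classic.
rewrite (_ : [set z | _] = [set z : 'rV[R]_(1 + d) | forall i, A i (z ord0 i)]).
  apply: rV_compact => i; rewrite /A; case: fintype.split => _;
    exact: segment_compact.
apply/seteqP; split=> z /= => [[zt zx] i|zA].
  rewrite /A; case: splitP => j ij.
    rewrite /= in_itv /= (_ : i = tdir d)//; apply: val_inj => /=.
    by rewrite ij ord1.
  have -> : i = sdir j by exact: val_inj.
  by rewrite /= in_itv /= -ler_norml -space_ofE; exact: zx.
split=> [|j].
  have := zA (tdir d); rewrite /A /tdir; case: splitP => [_ _|j /= /eqP//].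
  by rewrite /= in_itv.
have := zA (sdir j); rewrite /A /sdir; case: splitP => [k /= jk|k _].
  by have := ltn_ord k; rewrite -jk.
by rewrite /= in_itv /= -ler_norml space_ofE.
Qed.

Lemma cylinder_bound d (a b : R) (G : 'rV[R]_(1 + d) -> R) :
  (forall z, a <= time_of z <= b -> {for z, continuous G}) ->
  exists2 C, 0 <= C &
    forall t x, a <= t <= b -> box x -> `|G (point t x)| <= C.
Proof.
move=> Gc; set K := [set z : 'rV[R]_(1 + d) | a <= time_of z <= b /\ box (space_of z)].
have /compact_bounded[M [_ MP]] : compact (G @` K).
  apply: continuous_compact; last exact: cylinder_compact.
  by apply: continuous_in_subspaceT => z /set_mem[zt _]; exact: Gc.
exists (`|M| + 1) => [|t x tab xL]; first by rewrite addr_ge0.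
apply: (MP (`|M| + 1)); first by rewrite (le_lt_trans (ler_norm _))// ltrDl.
by exists (point t x) => //; split; rewrite ?time_of_point ?space_of_point.
Qed.

End BoxIntegral.

(** * Continuity, additivity and monotonicity of box integrals *)

Section BoxIntegralCalculus.
Variables (R : realType) (L : R).
Hypothesis L_gt0 : 0 < L.

Local Notation mu := (@lebesgue_measure R).

(** Prepares inductions on the dimension: time stays in first position while the first space
    coordinate is frozen at [s], which leaves a function of one variable fewer. *)
Lemma continuous_insert d (G : 'rV[R]_(1 + (1 + d)) -> R) (s : R) z :
  {for point (time_of z) (point s (space_of z)), continuous G} ->
  {for z, continuous (fun z : 'rV[R]_(1 + d) =>
     G (point (time_of z) (point s (space_of z))))}.
Proof.
move=> Gc; apply: (@continuous_comp _ _ _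
  (fun z : 'rV_(1 + d) => point (time_of z) (point s (space_of z))) G) => //.
apply: continuous_point; first exact: continuous_time_of.
apply: continuous_point; first exact: cst_continuous.
exact: continuous_space_of.
Qed.

Lemma continuous_slice d (G : 'rV[R]_(1 + d) -> R) t x :
  {for point t x, continuous G} ->
  {for x, continuous (fun y => G (point t y))}.
Proof.
move=> Gc; apply: (@continuous_comp _ _ _ (fun y => point t y) G) => //.
by apply: continuous_point; [exact: cst_continuous | exact: cvg_id].
Qed.

(** Dominated convergence in the outermost variable. The dominating constant comes from compactness
    and exists only on a subinterval around [t] whose closure stays inside the open interval. The
    induction hypothesis serves twice: with the outer space variable in the role of time it gives
    integrability, and with time itself it gives continuity of the inner integral. *)
Lemma continuous_box_integral d (a b : R) (G : 'rV[R]_(1 + d) -> R) :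
  (forall z, a < time_of z < b -> {for z, continuous G}) ->
  forall t, a < t < b ->
  {for t, continuous (fun t => box_integral L (fun x => G (point t x)))}.
Proof.
elim: d a b G => [|d IHd] a b G Gc t tab /=.
  apply: (@continuous_comp _ _ _ (fun t => point t 0) G).
    by apply: continuous_point; [exact: cvg_id | exact: cst_continuous].
  by apply: Gc; rewrite time_of_point.
have [t1 [t2 [at1 t1t tt2 t2b]]] :
    exists t1 t2, [/\ a < t1, t1 < t, t < t2 & t2 < b].
  by move: tab => /andP[at_ tb]; exists ((a + t) / 2), ((t + b) / 2); split; lra.
have [C C0 GC] : exists2 C, 0 <= C & forall s x, t1 <= s <= t2 -> box L x ->
    `|G (point s x)| <= C.
  by apply: cylinder_bound => // z /andP[z1 z2]; apply: Gc; apply/andP; split; lra.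
have in_ab s : `]t1, t2[%classic s -> a < s < b.
  by rewrite /= in_itv /= => /andP[s1 s2]; apply/andP; split; lra.
pose f t s := box_integral L (fun x : 'rV[R]_d => G (point t (point s x))).
apply: (@continuity_under_integral _ _ _ mu f _ _ t1 t2 _ _
  (fun=> C * (2 * L) ^+ d)) => //.
- move=> r /in_ab rab; apply: continuous_itv_integrable => s.
  apply: (IHd (s - 1) (s + 1) (fun z => G (point r z))).
    move=> z _; apply: continuous_slice.
    by apply: Gc; rewrite time_of_point.
  by apply/andP; split; lra.
- apply: aeW => s _ r /set_mem/in_ab rab.
  have := IHd a b (fun z => G (point (time_of z) (point s (space_of z)))).
  have -> : (fun t => box_integral L (fun x : 'rV_d =>
      G (point (time_of (point t x)) (point s (space_of (point t x)))))) = f ^~ s.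
    by apply/funext => u; congr box_integral; apply/funext => x;
      rewrite time_of_point space_of_point.
  apply=> // z zab; apply: continuous_insert.
  by apply: Gc; rewrite time_of_point.
- by apply: continuous_itv_integrable; exact: cst_continuous.
- move=> r; rewrite /= in_itv /= => /andP[r1 r2]; apply: aeW => s sL.
  apply: box_integral_bound => // x xL; apply: GC; last exact: box_point.
  by rewrite !ltW.
- by rewrite inE /= in_itv /= t1t tt2.
Qed.

Lemma integrable_box_integral d (G : 'rV[R]_(1 + d) -> R) :
  continuous G ->
  mu.-integrable `[(- L), L]%classic
    (EFin \o (fun s => box_integral L (fun x => G (point s x)))).
Proof.
move=> Gc; apply: continuous_itv_integrable => s.
apply: (@continuous_box_integral _ (s - 1) (s + 1)) => [z _|]; first exact: Gc.
by apply/andP; split; lra.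
Qed.

Lemma continuous_slice_total d (G : 'rV[R]_(1 + d) -> R) s :
  continuous G -> continuous (fun x => G (point s x)).
Proof. by move=> Gc x; exact/continuous_slice/Gc. Qed.

Lemma box_integralD d (g h : 'rV[R]_d -> R) : continuous g -> continuous h ->
  box_integral L (g + h) = box_integral L g + box_integral L h.
Proof.
elim: d g h => [//|d IHd] g h gc hc /=.
rewrite -RintegralD//; try exact: integrable_box_integral.
by apply: eq_Rintegral => s _; apply: IHd; exact: continuous_slice_total.
Qed.

Lemma box_integral_sum d n (g : 'I_n -> 'rV[R]_d -> R) :
  (forall i, continuous (g i)) ->
  box_integral L (\sum_i g i) = \sum_i box_integral L (g i).
Proof.
elim: n g => [|n IHn] g gc; first by rewrite !big_ord0 (box_integral_cst L_gt0) mul0r.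
rewrite !big_ord_recl box_integralD// ?IHn//.
elim/big_ind : _ => [|u v uc vc|i _]; [exact: cst_continuous | | exact: gc].
by move=> x; apply: continuousD; [exact: uc | exact: vc].
Qed.

Lemma box_integral_le d (g h : 'rV[R]_d -> R) : continuous g -> continuous h ->
  (forall x, box L x -> g x <= h x) -> box_integral L g <= box_integral L h.
Proof.
elim: d g h => [|d IHd] g h gc hc gh /=; first by apply: gh => -[].
apply: le_Rintegral => //; try exact: integrable_box_integral.
move=> s sL; apply: IHd; try exact: continuous_slice_total.
by move=> x xL; apply: gh; exact: box_point.
Qed.

(** Since [g] is nonnegative on the box, restricting each variable in turn to a side of the cube can
    only lower the integral. This converts a large value at one point, spread over a cube, into a
    lower bound for the energy. *)
Lemma box_integral_ge_cube d (g : 'rV[R]_d -> R) (x0 : 'rV[R]_d) (k c : R) :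
  continuous g -> 0 <= k -> 0 <= c -> (forall j, `|x0 0 j| + k <= L) ->
  (forall x, box L x -> 0 <= g x) ->
  (forall x : 'rV[R]_d, (forall j, `|x 0 j - x0 0 j| <= k) -> c <= g x) ->
  c * (2 * k) ^+ d <= box_integral L g.
Proof.
move=> gc k0 c0; elim: d g x0 gc => [|d IHd] g x0 gc x0L g0 gk /=.
  by rewrite expr0 mulr1; apply: gk => -[].
set F := fun s : R => box_integral L (fun x : 'rV[R]_d => g (point s x)).
pose t0 := time_of (x0 : 'rV_(1 + d)).
have sub : `[t0 - k, t0 + k]%classic `<=` `[(- L), L]%classic.
  have := x0L (tdir d); rewrite -/(time_of (x0 : 'rV_(1 + d))) -/t0 -lerBrDr ler_norml.
  move=> /andP[? ?] s; rewrite /= !in_itv /= => /andP[? ?].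
  by apply/andP; split; lra.
have Fi := integrable_box_integral gc; rewrite -/F in Fi.
have F0 s : `[(- L), L]%classic s -> 0 <= F s.
  move=> sL; have := @box_integral_le d (fun=> 0) (fun x => g (point s x)).
  rewrite (box_integral_cst L_gt0) mul0r; apply.
  - exact: cst_continuous.
  - exact: continuous_slice_total.
  - by move=> x xL; apply: g0; exact: box_point.
have -> : c * (2 * k) ^+ d.+1 =
    \int[mu]_(s in `[t0 - k, t0 + k]) (c * (2 * k) ^+ d).
  rewrite Rintegral_cst//= fine_lebesgue_itvcc; last by lra.
  by rewrite exprSr -mulrA; congr (_ * (_ * _)); lra.
apply: (@le_trans _ _ (\int[mu]_(s in `[t0 - k, t0 + k]) F s)).
  apply: le_Rintegral => //.
  - by apply: continuous_itv_integrable; exact: cst_continuous.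
  - exact: integrableS Fi.
  move=> s sk; apply: (IHd _ (space_of (x0 : 'rV_(1 + d)))).
  - exact: continuous_slice_total.
  - by move=> j; rewrite space_ofE.
  - by move=> x xL; apply: g0; apply: box_point => //; exact: sub.
  move=> x xk; apply: gk => j; case: (split_ordP (j : 'I_(1 + d))) => i ->.
    rewrite -/(tdir d) ord1 -/(tdir d).
    rewrite -[point s x 0 _]/(time_of (point s x)) time_of_point.
    rewrite -/(time_of (x0 : 'rV_(1 + d))) -/t0.
    by move: sk; rewrite /= in_itv /= ler_distl.
  by rewrite -/(sdir i) point_sdir; have := xk i; rewrite space_ofE.
rewrite /Rintegral fine_le//.
- by apply: integrable_fin_num => //; exact: integrableS Fi.
- exact: integrable_fin_num.
apply: ge0_subset_integral => //.
  by have /integrableP[] := Fi.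
Qed.

End BoxIntegralCalculus.

(** * Differentiation under box integrals and integration of partial derivatives *)

Section BoxIntegralDerivative.
Variables (R : realType) (L : R).
Hypothesis L_gt0 : 0 < L.

Local Notation mu := (@lebesgue_measure R).

Lemma is_derive_insert d (G : 'rV[R]_(1 + (1 + d)) -> R) (s g' : R) z :
  is_derive (point (time_of z) (point s (space_of z)))
    (delta_mx 0 (tdir (1 + d))) G g' ->
  is_derive z (delta_mx 0 (tdir d))
    (fun z => G (point (time_of z) (point s (space_of z)))) g'.
Proof.
apply: (@is_derive_affine R _ _ G
  (fun z : 'rV_(1 + d) => point (time_of z) (point s (space_of z)))
  z (delta_mx 0 (tdir d)) _ g' _).1 => h.
rewrite -point_time_line; congr point.
  by rewrite /time_of !mxE !eqxx.
congr point; apply/rowP => j; rewrite !space_ofE !mxE.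
by rewrite /sdir /tdir eq_rlshift andbF mulr0 add0r.
Qed.

(** Same induction as for continuity: on a compact subinterval of times [G'] is bounded on the box,
    and the constant bound dominates the derivative of the inner integral. *)
Lemma is_derive_box_integral d (a b : R) (G G' : 'rV[R]_(1 + d) -> R) :
  (forall z, a < time_of z < b -> {for z, continuous G}) ->
  (forall z, a < time_of z < b -> {for z, continuous G'}) ->
  (forall z, a < time_of z < b -> is_derive z (delta_mx 0 (tdir d)) G (G' z)) ->
  forall t, a < t < b ->
  is_derive t 1 (fun t => box_integral L (fun x => G (point t x)))
    (box_integral L (fun x => G' (point t x))).
Proof.
elim: d a b G G' => [|d IHd] a b G G' Gc G'c dG t tab /=.
  by apply: is_derive_time; apply: dG; rewrite time_of_point.
have [t1 [t2 [at1 t1t tt2 t2b]]] :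
    exists t1 t2, [/\ a < t1, t1 < t, t < t2 & t2 < b].
  by move: tab => /andP[at_ tb]; exists ((a + t) / 2), ((t + b) / 2); split; lra.
have [C C0 GC] : exists2 C, 0 <= C & forall s x, t1 <= s <= t2 -> box L x ->
    `|G' (point s x)| <= C.
  by apply: cylinder_bound => // z /andP[z1 z2]; apply: G'c; apply/andP; split; lra.
have in_ab s : `]t1, t2[%classic s -> a < s < b.
  by rewrite /= in_itv /= => /andP[s1 s2]; apply/andP; split; lra.
pose f t s := box_integral L (fun x : 'rV[R]_d => G (point t (point s x))).
pose f' t s := box_integral L (fun x : 'rV[R]_d => G' (point t (point s x))).
have insertE (H : 'rV[R]_(1 + (1 + d)) -> R) s r :
    box_integral L (fun x : 'rV_d =>
      H (point (time_of (point r x)) (point s (space_of (point r x))))) =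
    box_integral L (fun x : 'rV[R]_d => H (point r (point s x))).
  by congr box_integral; apply/funext => x; rewrite time_of_point space_of_point.
have df r s : a < r < b -> is_derive (r : R^o) 1 (f ^~ s) (f' r s).
  move=> rab; have := IHd a b
    (fun z => G (point (time_of z) (point s (space_of z))))
    (fun z => G' (point (time_of z) (point s (space_of z)))).
  rewrite (_ : (fun t => box_integral L _) = f ^~ s); last first.
    by apply/funext => u; rewrite insertE.
  move=> /(_ _ _ _ r rab); rewrite insertE; apply.
  - by move=> z zab; apply/continuous_insert/Gc; rewrite time_of_point.
  - by move=> z zab; apply/continuous_insert/G'c; rewrite time_of_point.
  - by move=> z zab; apply/is_derive_insert/dG; rewrite time_of_point.
have t12 : `]t1, t2[%classic t by rewrite /= in_itv /= t1t tt2.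
have f_int r : `]t1, t2[%classic r ->
    mu.-integrable `[(- L), L]%classic (EFin \o f r).
  move=> /in_ab rab; apply: continuous_itv_integrable => s.
  apply: (@continuous_box_integral _ _ L_gt0 _ (s - 1) (s + 1)
    (fun z => G (point r z))).
    move=> z _; apply: continuous_slice.
    by apply: Gc; rewrite time_of_point.
  by apply/andP; split; lra.
have df1 r s : `]t1, t2[%classic r -> `[(- L), L]%classic s ->
    derivable (f ^~ s) r 1.
  by move=> /in_ab rab _; case: (df r s rab).
have C_int : mu.-integrable `[(- L), L]%classic
    (EFin \o (fun=> C * (2 * L) ^+ d)).
  by apply: continuous_itv_integrable; exact: cst_continuous.
have C_ge0 (s : R) : 0 <= C * (2 * L) ^+ d.
  by have L0 := L_gt0; apply: mulr_ge0 => //; apply: exprn_ge0; lra.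
have f'_ub r s : `]t1, t2[%classic r -> `[(- L), L]%classic s ->
    `|partial1of2 f r s| <= C * (2 * L) ^+ d.
  move=> rI sL; rewrite partial1of2E.
  have [_ ->] := df r s (in_ab _ rI).
  apply: box_integral_bound => // x xL; apply: GC; last exact: box_point.
  by move: rI; rewrite /= in_itv /= => /andP[? ?]; rewrite !ltW.
split.
  by apply: (@derivable_under_integral _ _ _ mu f _ _ _ _ _ t12 f_int df1 _
    C_ge0 C_int f'_ub).
rewrite -derive1E.
rewrite (@differentiation_under_integral _ _ _ mu f _ _ _ _ _ t12 f_int df1 _
  C_ge0 C_int f'_ub)//.
by apply: eq_Rintegral => s _; rewrite partial1of2E; case: (df t s tab).
Qed.

(** One component of the divergence theorem. If [j] is the outermost variable, differentiation under
    the inner integrals turns the claim into the fundamental theorem of calculus for [H], which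
    vanishes at both ends. Otherwise every inner integral is already zero by induction. *)
Lemma box_integral_partial d (j : 'I_d) (F F' : 'rV[R]_d -> R) :
  continuous F -> continuous F' ->
  (forall x, is_derive x (delta_mx 0 j) F (F' x)) ->
  (forall x : 'rV[R]_d, `|x 0 j| = L -> F x = 0) ->
  box_integral L F' = 0.
Proof.
have L0 := L_gt0; have NLL : - L < L by lra.
elim: d j F F' => [[]//|d IHd] j F F' Fc F'c dF F0.
case: (split_ordP (j : 'I_(1 + d))) => i jE /=.
  have {}jE : j = tdir d by rewrite jE ord1.
  pose H s := box_integral L (fun x : 'rV[R]_d => F (point s x)).
  pose H' s := box_integral L (fun x : 'rV[R]_d => F' (point s x)).
  have nearby (s : R) : s - 1 < s < s + 1 by apply/andP; split; lra.
  have dH (s : R) : is_derive s 1 H (H' s).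
    apply: (is_derive_box_integral (a := s - 1) (b := s + 1)) => // z _.
    - exact: Fc.
    - exact: F'c.
    - by have := dF z; rewrite jE.
  have Hc : continuous H.
    move=> s; apply: (continuous_box_integral L_gt0 (a := s - 1) (b := s + 1)) => // z _.
    exact: Fc.
  have H'c : continuous H'.
    move=> s; apply: (continuous_box_integral L_gt0 (a := s - 1) (b := s + 1)) => // z _.
    exact: F'c.
  have H_eq0 s : `|s| = L -> H s = 0.
    move=> sL; rewrite /H (_ : (fun x => _) = fun=> 0).
      by rewrite (box_integral_cst L_gt0) mul0r.
    apply/funext => x; apply: F0.
    by rewrite jE -[point s x 0 _]/(time_of (point s x)) time_of_point.
  rewrite -[LHS]/(fine (\int[mu]_(s in `[(- L)%R, L]) (H' s)%:E)%E).
  rewrite (@continuous_FTC2 _ H' H)//.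
  - by rewrite !H_eq0 ?normrN ?gtr0_norm//= subrr.
  - exact: continuous_subspaceT.
  - split=> [s _||]; first by case: (dH s).
      exact/cvg_at_right_filter/Hc.
    exact/cvg_at_left_filter/Hc.
  - by move=> s _; rewrite derive1E; case: (dH s).
rewrite (_ : (fun s => _) = fun=> 0).
  by rewrite /Rintegral integral0_eq.
apply/funext => s; apply: (IHd i (fun x => F (point s x))).
- exact: continuous_slice_total.
- exact: continuous_slice_total.
- by move=> x; apply: is_derive_space; rewrite /sdir -jE.
- by move=> x xi; apply: F0; rewrite jE -/(sdir i) point_sdir.
Qed.

End BoxIntegralDerivative.

(** * Light-cone cutoff and energy *)

Section PointwiseCalculus.
Variables (R : realType) (V : normedModType R).
Implicit Types (f g : V -> R) (z v : V).

Lemma is_derive_add f g z v (f' g' : R) :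
  is_derive z v f f' -> is_derive z v g g' ->
  is_derive z v (fun y => f y + g y) (f' + g').
Proof. exact: is_deriveD. Qed.

Lemma is_derive_mul f g z v (f' g' : R) :
  is_derive z v f f' -> is_derive z v g g' ->
  is_derive z v (fun y => f y * g y) (f z * g' + g z * f').
Proof. exact: is_deriveM. Qed.

Lemma is_derive_sqr f z v (f' : R) : is_derive z v f f' ->
  is_derive z v (fun y => f y ^+ 2) (2 * f z * f').
Proof.
move=> df; rewrite (_ : 2 * f z * f' = f z * f' + f z * f'); last by ring.
exact: is_derive_mul.
Qed.

Lemma is_derive_bigsum n (f : 'I_n -> V -> R) z v (f' : 'I_n -> R) :
  (forall i, is_derive z v (f i) (f' i)) ->
  is_derive z v (fun y => \sum_i f i y) (\sum_i f' i).
Proof. by rewrite -fct_sumE; exact: is_derive_sum. Qed.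

(** Restriction to the line through [z] in direction [v] reduces the claim to the one-variable chain
    rule, so a directional derivative of [f] suffices. *)
Lemma is_derive_chain (g : R -> R) f z v (f' g' : R) :
  is_derive (f z) (1 : R) g g' -> is_derive z v f f' ->
  is_derive z v (g \o f) (g' * f').
Proof.
pose l (h : R) : V := h *: v + z.
have lE (h : R^o) : l (h *: (1 : R^o) + 0) = h *: v + l 0.
  by rewrite /l scale0r add0r addr0 [h *: 1]mulr1.
have l0 : l 0 = z by rewrite /l scale0r add0r.
have lines (k : V -> R) k' :
    is_derive z v k k' <-> is_derive (0 : R^o) (1 : R^o) (k \o l) k'.
  by rewrite -(@is_derive_affine R R^o V k l 0 1 v k' lE) l0.
move=> dg /lines df; apply/lines.
by apply: (@is_derive1_comp R g (f \o l) 0) => /=; rewrite ?l0.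
Qed.

End PointwiseCalculus.

Lemma continuous_bigsum (R : realType) (T : topologicalType) n
    (f : 'I_n -> T -> R) z :
  (forall i, {for z, continuous (f i)}) ->
  {for z, continuous (fun y => \sum_i f i y)}.
Proof.
move=> fc; rewrite -fct_sumE; elim/big_ind : _ => [|g h gc hc|i _].
- exact: cst_continuous.
- exact: continuousD.
- exact: fc.
Qed.

Lemma continuous_add (R : realType) (T : topologicalType) (f g : T -> R) z :
  {for z, continuous f} -> {for z, continuous g} ->
  {for z, continuous (fun y => f y + g y)}.
Proof. exact: continuousD. Qed.

Lemma continuous_sub (R : realType) (T : topologicalType) (f g : T -> R) z :
  {for z, continuous f} -> {for z, continuous g} ->
  {for z, continuous (fun y => f y - g y)}.
Proof. exact: continuousB. Qed.

Lemma continuous_mul (R : realType) (T : topologicalType) (f g : T -> R) z :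
  {for z, continuous f} -> {for z, continuous g} ->
  {for z, continuous (fun y => f y * g y)}.
Proof. exact: continuousM. Qed.

Lemma continuous_sqr (R : realType) (T : topologicalType) (f : T -> R) z :
  {for z, continuous f} -> {for z, continuous (fun y => f y ^+ 2)}.
Proof. by move=> fc; exact: (continuousM fc fc). Qed.

Section Cutoff.
Variables (R : realType) (d : nat) (A : R).
Implicit Types z : 'rV[R]_(1 + d).

Definition pos_sqr (y : R) : R := Num.max y 0 ^+ 2.

(** The first-order Taylor remainder is at most [h ^+ 2] in absolute value, in each of the four sign
    cases for [y] and [h + y]. *)
Lemma is_derive_pos_sqr (y : R) : is_derive y (1 : R) pos_sqr (2 * Num.max y 0).
Proof.
have quot : h^-1 *: ((pos_sqr \o shift y) (h *: (1 : R)) - pos_sqr y)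
    @[h --> (0 : R)^'] --> 2 * Num.max y 0.
  apply/cvgrPdist_le => e e0; near=> h.
  have h0 : h != 0 by near: h; exact: nbhs_dnbhs_neq.
  have he : `|h| <= e.
    by near: h; apply: dnbhs0_le.
  apply: le_trans he; rewrite /= [h *: 1]mulr1 -[h^-1 *: _]/(h^-1 * _).
  rewrite -(ler_pM2l (_ : 0 < `|h|)) ?normr_gt0// -normrM mulrBr mulVKf//.
  rewrite -expr2 real_normK ?num_real// /pos_sqr ler_norml.
  have [hy|hy] := lerP (h + y) 0; have [y0|y0] := lerP y 0;
    apply/andP; split; nra.
by split; [apply/cvg_ex; exists (2 * Num.max y 0) | exact: cvg_lim quot].
Unshelve. all: by end_near. Qed.

Lemma is_derive_coord n (z v : 'rV[R]_n) i :
  is_derive z v (fun y : 'rV[R]_n => y 0 i) (v 0 i).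
Proof.
apply: (@is_derive_affine R _ R^o id (fun y : 'rV[R]_n => y 0 i) z v (v 0 i)
  (v 0 i) _).1 => h.
by rewrite !mxE.
Qed.

(* On [{A > t}] the set [{cone > 0}] is the backward light cone
   [{|x| < A - t}]. *)
Definition cone z : R :=
  (A - time_of z) ^+ 2 - \sum_j (z 0 (sdir j)) ^+ 2.

Lemma is_derive_cone z v : is_derive z v cone
  (2 * (A - time_of z) * - v 0 (tdir d) +
   - \sum_j (2 * z 0 (sdir j) * v 0 (sdir j))).
Proof.
apply: is_derive_add.
  apply: is_derive_sqr; rewrite -[- v 0 _]add0r.
  apply: (@is_derive_add _ _ (cst A)).
  exact/is_deriveN/is_derive_coord.
apply: is_deriveN; apply: is_derive_bigsum => j.
exact/is_derive_sqr/is_derive_coord.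
Qed.

Definition cutoff z : R := pos_sqr (cone z).

Lemma is_derive_cutoff_time z : is_derive z (delta_mx 0 (tdir d)) cutoff
  (- (4 * Num.max (cone z) 0 * (A - time_of z))).
Proof.
rewrite (_ : - _ = 2 * Num.max (cone z) 0 * (2 * (A - time_of z) *
   - (delta_mx 0 (tdir d) : 'rV[R]_(1 + d)) 0 (tdir d) +
   - \sum_j (2 * z 0 (sdir j) *
      (delta_mx 0 (tdir d) : 'rV[R]_(1 + d)) 0 (sdir j)))).
  by apply: is_derive_chain; [exact: is_derive_pos_sqr | exact: is_derive_cone].
rewrite big1 => [|j _]; first by rewrite mxE !eqxx /=; ring.
by rewrite mxE /sdir /tdir eq_rlshift andbF mulr0.
Qed.

Lemma is_derive_cutoff_space z j : is_derive z (delta_mx 0 (sdir j)) cutoff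
  (- (4 * Num.max (cone z) 0 * z 0 (sdir j))).
Proof.
rewrite (_ : - _ = 2 * Num.max (cone z) 0 * (2 * (A - time_of z) *
   - (delta_mx 0 (sdir j) : 'rV[R]_(1 + d)) 0 (tdir d) +
   - \sum_i (2 * z 0 (sdir i) *
      (delta_mx 0 (sdir j) : 'rV[R]_(1 + d)) 0 (sdir i)))).
  by apply: is_derive_chain; [exact: is_derive_pos_sqr | exact: is_derive_cone].
rewrite (bigD1 j)//= big1 => [|i ij].
  by rewrite !mxE !eqxx /sdir /tdir eq_lrshift andbF /=; ring.
by rewrite mxE /sdir eq_rshift (negbTE ij) andbF mulr0.
Qed.

Lemma continuous_cone : continuous cone.
Proof.
move=> z; apply: (@continuous_sub _ _ (fun z => (A - time_of z) ^+ 2)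
  (fun z => \sum_j z 0 (sdir j) ^+ 2)).
  apply: continuous_sqr; apply: continuous_sub; first exact: cst_continuous.
  exact: continuous_time_of.
by apply: continuous_bigsum => j; apply: continuous_sqr; exact: coord_continuous.
Qed.

Lemma continuous_pos_cone : continuous (fun z => Num.max (cone z) 0).
Proof.
move=> z; apply: continuous_max; first exact: continuous_cone.
exact: cst_continuous.
Qed.

Lemma continuous_cutoff : continuous cutoff.
Proof.
move=> z; apply: (@continuous_sqr _ _ (fun z => Num.max (cone z) 0)).
exact: continuous_pos_cone.
Qed.

Lemma cutoff_ge0 z : 0 <= cutoff z.
Proof. exact: sqr_ge0. Qed.

Lemma cutoff_le z : 0 <= time_of z <= A -> cutoff z <= A ^+ 4.
Proof.
move=> /andP[z0 zA]; rewrite /cutoff /pos_sqr (exprM A 2 2).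
have S0 : 0 <= \sum_j (z 0 (sdir j)) ^+ 2 by apply: sumr_ge0 => j _; exact: sqr_ge0.
rewrite lerXn2r ?nnegrE ?le_max ?lexx ?orbT ?sqr_ge0// ge_max sqr_ge0 andbT /cone.
by nra.
Qed.

(** A single large coordinate already places the point outside the light cone. This is how the
    cutoff is seen to vanish on the faces of the box of integration. *)
Lemma cutoff_out z j : `|A - time_of z| <= `|z 0 (sdir j)| -> cutoff z = 0.
Proof.
move=> zj; rewrite /cutoff /pos_sqr max_r ?expr0n// /cone subr_le0.
rewrite (bigD1 j)//= -[leLHS]addr0; apply: lerD.
  by rewrite -real_normK ?num_real// -[leRHS]real_normK ?num_real// lerXn2r ?nnegrE.
by apply: sumr_ge0 => i _; exact: sqr_ge0.
Qed.

End Cutoff.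

(** Expanding the nonnegative sum of the squares of [p * b j - w * x j] and using [|x| <= p] gives
    the claim multiplied by [p]. With [p = A - t] it says that the loss from the shrinking cone
    outweighs the flux through its lateral boundary. *)
Lemma cone_quadratic (R : realType) n (p w : R) (b x : 'I_n -> R) :
  0 < p -> \sum_j x j ^+ 2 <= p ^+ 2 ->
  2 * w * \sum_j (x j * b j) <= p * (w ^+ 2 + \sum_j b j ^+ 2).
Proof.
move=> p0 xp; rewrite -(ler_pM2l p0).
have : 0 <= \sum_j (p * b j - w * x j) ^+ 2.
  by apply: sumr_ge0 => j _; exact: sqr_ge0.
have -> : \sum_j (p * b j - w * x j) ^+ 2 =
    p ^+ 2 * \sum_j b j ^+ 2 - 2 * p * w * \sum_j (x j * b j) +
    w ^+ 2 * \sum_j x j ^+ 2.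
  rewrite !mulr_sumr -sumrB -big_split /=; apply: eq_bigr => j _; ring.
have := ler_wpM2l (sqr_ge0 w) xp.
by nra.
Qed.

(** * The local energy inequality *)

Section Energy.
Variables (R : realType) (d : nat) (T A L M eta : R).
Local Notation st := 'rV[R]_(1 + d).
Variables (w wt : st -> R) (b wx bx : 'I_d -> st -> R).
Hypotheses (TA : T < A) (AL : A < L).
Let e_t : st := delta_mx 0 (tdir d).
Let e_x j : st := delta_mx 0 (sdir j).

(* [w] and [b j] stand for the time and space derivatives of a solution of the
   wave equation; [wt], [wx j], [bx j] for its second derivatives. *)
Hypotheses (w_c : forall z, open_slab T z -> {for z, continuous w})
  (wt_c : forall z, open_slab T z -> {for z, continuous wt})
  (b_c : forall j z, open_slab T z -> {for z, continuous (b j)})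
  (wx_c : forall j z, open_slab T z -> {for z, continuous (wx j)})
  (bx_c : forall j z, open_slab T z -> {for z, continuous (bx j)}).
Hypotheses (dw_t : forall z, open_slab T z -> is_derive z e_t w (wt z))
  (dw_x : forall j z, open_slab T z -> is_derive z (e_x j) w (wx j z))
  (db_t : forall j z, open_slab T z -> is_derive z e_t (b j) (wx j z))
  (db_x : forall j z, open_slab T z -> is_derive z (e_x j) (b j) (bx j z)).
Hypotheses
  (w_le : forall z, open_slab T z -> box L (space_of z) -> `|w z| <= M)
  (wave_le : forall z, open_slab T z -> box L (space_of z) ->
    `|wt z - \sum_j bx j z| <= eta).

Definition energy_density (z : st) : R := w z ^+ 2 + \sum_j b j z ^+ 2.
Definition energy t : R :=
  box_integral L (fun x => cutoff A (point t x) * energy_density (point t x)).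

Let pc (z : st) : R := Num.max (cone A z) 0.
Let dt_energy (z : st) : R :=
  cutoff A z * (2 * w z * wt z + \sum_j (2 * b j z * wx j z)) +
  energy_density z * - (4 * pc z * (A - time_of z)).
(** Energy flux weighted by the cutoff. Without the weight, the time derivative of [energy_density]
    minus the divergence of [2 * (w * b j)] is [2 * w * (wt - \sum_j bx j)], because the mixed terms
    cancel. *)
Let flux j (z : st) : R := cutoff A z * (2 * (w z * b j z)).
Let dx_flux j (z : st) : R :=
  cutoff A z * (2 * (w z * bx j z + b j z * wx j z)) +
  2 * (w z * b j z) * - (4 * pc z * z 0 (sdir j)).

Let is_derive_energy z : open_slab T z ->
  is_derive z e_t (fun z => cutoff A z * energy_density z) (dt_energy z).
Proof.
move=> zT; exact: (is_derive_mul (is_derive_cutoff_time A z)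
  (is_derive_add (is_derive_sqr (dw_t zT))
    (is_derive_bigsum (fun j => is_derive_sqr (db_t j zT))))).
Qed.

Let is_derive_flux j z : open_slab T z ->
  is_derive z (e_x j) (flux j) (dx_flux j z).
Proof.
move=> zT; apply: is_derive_mul; first exact: is_derive_cutoff_space.
rewrite -[2 * (_ + _)]addr0 -(mulr0 (w z * b j z)).
apply: (@is_derive_mul _ _ (cst 2)).
by apply: is_derive_mul; [exact: dw_x | exact: db_x].
Qed.

Let cont_energy z : open_slab T z ->
  {for z, continuous (fun z => cutoff A z * energy_density z)}.
Proof.
move=> zT; apply: continuous_mul; first exact: continuous_cutoff.
apply: continuous_add; first exact/continuous_sqr/w_c.
by apply: continuous_bigsum => j; exact/continuous_sqr/b_c.
Qed.

Let cont_dt_energy z : open_slab T z -> {for z, continuous dt_energy}.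
Proof.
move=> zT; apply: continuous_add; apply: continuous_mul.
- exact: continuous_cutoff.
- apply: continuous_add.
    apply: continuous_mul; last exact: wt_c.
    by apply: continuous_mul; [exact: cst_continuous | exact: w_c].
  apply: continuous_bigsum => j; apply: continuous_mul; last exact: wx_c.
  by apply: continuous_mul; [exact: cst_continuous | exact: b_c].
- apply: continuous_add; first exact/continuous_sqr/w_c.
  by apply: continuous_bigsum => j; exact/continuous_sqr/b_c.
apply: continuousN; apply: continuous_mul.
  by apply: continuous_mul; [exact: cst_continuous | exact: continuous_pos_cone].
by apply: continuous_sub; [exact: cst_continuous | exact: continuous_time_of].
Qed.

Let cont_flux j z : open_slab T z -> {for z, continuous (flux j)}.
Proof.
move=> zT; apply: continuous_mul; first exact: continuous_cutoff.
apply: continuous_mul; first exact: cst_continuous.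
by apply: continuous_mul; [exact: w_c | exact: b_c].
Qed.

Let cont_dx_flux j z : open_slab T z -> {for z, continuous (dx_flux j)}.
Proof.
move=> zT; apply: continuous_add; apply: continuous_mul.
- exact: continuous_cutoff.
- apply: continuous_mul; first exact: cst_continuous.
  by apply: continuous_add; apply: continuous_mul;
    [exact: w_c | exact: bx_c | exact: b_c | exact: wx_c].
- apply: continuous_mul; first exact: cst_continuous.
  by apply: continuous_mul; [exact: w_c | exact: b_c].
apply: continuousN; apply: continuous_mul; last exact: coord_continuous.
by apply: continuous_mul; [exact: cst_continuous | exact: continuous_pos_cone].
Qed.

(** Two terms remain. The one with the wave operator is bounded by the hypotheses and [cutoff_le].
    The one with the derivatives of the cutoff vanishes outside the cone and is nonpositive inside
    it by [cone_quadratic]. *)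
Let energy_balance z : open_slab T z -> box L (space_of z) ->
  dt_energy z - \sum_j dx_flux j z <= 2 * A ^+ 4 * M * eta.
Proof.
move=> zT zL; have /andP[z0 z1] := zT; have TA' := TA.
have M0 : 0 <= M by apply: le_trans (w_le zT zL).
have -> : dt_energy z - \sum_j dx_flux j z =
    2 * (cutoff A z * w z * (wt z - \sum_j bx j z)) +
    4 * pc z * (2 * w z * \sum_j (z 0 (sdir j) * b j z) -
      (A - time_of z) * energy_density z).
  rewrite /dt_energy /dx_flux /energy_density big_split /=.
  have -> : \sum_j cutoff A z * (2 * (w z * bx j z + b j z * wx j z)) =
      cutoff A z * (2 * w z * \sum_j bx j z + \sum_j 2 * b j z * wx j z).
    rewrite mulrDr !mulr_sumr -big_split /=; apply: eq_bigr => j _; ring.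
  have -> : \sum_j 2 * (w z * b j z) * - (4 * pc z * z 0 (sdir j)) =
      - (4 * pc z) * (2 * w z * \sum_j (z 0 (sdir j) * b j z)).
    rewrite !mulr_sumr; apply: eq_bigr => j _; ring.
  ring.
rewrite -[leRHS]addr0; apply: lerD.
  rewrite (_ : 2 * A ^+ 4 * M * eta = 2 * (A ^+ 4 * M * eta)); last by ring.
  rewrite ler_pM2l//; apply: le_trans (ler_norm _) _.
  rewrite normrM; apply: ler_pM => //; last exact: wave_le.
  rewrite normrM (ger0_norm (cutoff_ge0 A z)); apply: ler_pM => //.
  - exact: cutoff_ge0.
  - by apply: cutoff_le; apply/andP; split; lra.
  - exact: w_le.
have [cz|cz] := lerP (cone A z) 0; first by rewrite /pc max_r// mulr0 mul0r.
rewrite mulr_ge0_le0//.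
  by rewrite /pc mulr_ge0// le_max lexx orbT.
rewrite subr_le0; apply: cone_quadratic; first lra.
by move: cz; rewrite /cone subr_gt0 => /ltW.
Qed.

Let point_slab t x : 0 < t < T -> open_slab T (point t x : st).
Proof. by rewrite /open_slab /= time_of_point. Qed.

(** The derivative of the energy is bounded by the integrated balance, and the mean value theorem on
    [[s, t]] concludes. The hypotheses live in the open slab, hence [0 < s] and [t < T]. *)
Lemma energy_le s t : 0 < s -> s <= t -> t < T ->
  energy t <= energy s + 2 * A ^+ 4 * M * eta * (2 * L) ^+ d * (t - s).
Proof.
move=> s0 st tT; have [TA' AL'] := (TA, AL).
have L0 : 0 < L by lra.
pose denergy u := box_integral L (fun x => dt_energy (point u x)).
have dE u : 0 < u < T -> is_derive u (1 : R) energy (denergy u).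
  move=> u0T; exact: (@is_derive_box_integral _ _ L0 _ 0 T
    (fun z => cutoff A z * energy_density z) dt_energy
    cont_energy cont_dt_energy is_derive_energy u u0T).
have denergy_le u : 0 < u < T -> denergy u <= 2 * A ^+ 4 * M * eta * (2 * L) ^+ d.
  move=> uT; have u_slab x := point_slab x uT; have /andP[u0 u1] := uT.
  pose g x := dt_energy (point u x) - \sum_j dx_flux j (point u x).
  have flux_c j : continuous (fun x => flux j (point u x)).
    by move=> x; apply: continuous_slice; exact: cont_flux.
  have dx_flux_c j : continuous (fun x => dx_flux j (point u x)).
    by move=> x; apply: continuous_slice; exact: cont_dx_flux.
  have dt_c : continuous (fun x => dt_energy (point u x)).
    by move=> x; apply: continuous_slice; exact: cont_dt_energy.
  have gc : continuous g.
    move=> x; apply: (@continuous_sub _ _ (fun x => dt_energy (point u x))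
      (fun x => \sum_j dx_flux j (point u x))); first exact: dt_c.
    by apply: continuous_bigsum => j; exact: dx_flux_c.
  have flux0 j : box_integral L (fun x => dx_flux j (point u x)) = 0.
    apply: (box_integral_partial L0 (j := j) (F := fun x => flux j (point u x))).
    - exact: flux_c.
    - exact: dx_flux_c.
    - by move=> x; apply/is_derive_space/is_derive_flux.
    move=> x xL; rewrite /flux (@cutoff_out _ _ _ _ j) ?mul0r//.
    rewrite point_sdir time_of_point xL ger0_norm; lra.
  (* Each flux vanishes on the faces [|x_j| = L] because [A - u < L]; the divergence integrates to
     zero and may be subtracted freely. *)
  have -> : denergy u = box_integral L g.
    rewrite /denergy (_ : (fun x => _) =
      g + \sum_j (fun x => dx_flux j (point u x))).
      rewrite box_integralD//; last first.
        rewrite fct_sumE => x.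
        apply: (@continuous_bigsum _ _ _ (fun j x => dx_flux j (point u x))) => j.
        exact: dx_flux_c.
      by rewrite box_integral_sum// big1 ?addr0.
    by apply/funext => x; rewrite fct_sumE /g /= [RHS]subrK.
  rewrite -(box_integral_cst L0 d); apply: box_integral_le => //.
    by move=> x; exact: cst_continuous.
  by move=> x xL; apply: energy_balance => //; rewrite space_of_point.
have in_slab u : s <= u <= t -> 0 < u < T by lra.
have [c sct Ets] : exists2 c, c \in `[s, t] &
    energy t - energy s = denergy c * (t - s).
  apply: MVT_segment => // [u|].
    rewrite in_itv /= => /andP[su ut].
    by apply: dE; apply: in_slab; rewrite !ltW.
  apply: derivable_within_continuous => u; rewrite in_itv /= => sut.
  by have [] := dE u (in_slab u sut).
rewrite -lerBlDl Ets ler_wpM2r ?subr_ge0//; apply: denergy_le; apply: in_slab.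
by move: sct; rewrite in_itv.
Qed.

End Energy.

(** * Schwarz's theorem *)

Section Schwarz.
Variables (R : realType) (V : normedModType R).
Implicit Types (f : V -> R) (u v y z : V).

Lemma is_derive_line f u y (s f' : R) :
  is_derive (s *: u + y) u f f' ->
  is_derive s (1 : R) (fun s => f (s *: u + y)) f'.
Proof.
apply: (@is_derive_affine R R^o V f (fun s => s *: u + y) s 1 u f' _).1 => h.
by rewrite [h *: 1]mulr1 scalerDl addrA.
Qed.

Lemma MVT_line f (f' : V -> R) u y (h : R) : 0 < h ->
  (forall s, 0 <= s <= h -> is_derive (s *: u + y) u f (f' (s *: u + y))) ->
  exists2 s, 0 < s < h & f (h *: u + y) - f y = f' (s *: u + y) * h.
Proof.
move=> h0 df.
have dg (s : R) : 0 <= s <= h ->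
    is_derive s (1 : R) (fun s => f (s *: u + y)) (f' (s *: u + y)).
  by move=> sh; exact/is_derive_line/df.
have [||s sh E] := @MVT R (fun s => f (s *: u + y)) (fun s => f' (s *: u + y)) 0 h h0.
- by move=> s; rewrite in_itv /= => /andP[s0 s1]; apply: dg; rewrite !ltW.
- apply: derivable_within_continuous => s; rewrite in_itv /= => sh.
  by have [] := dg s sh.
exists s; first by move: sh; rewrite in_itv.
by move: E; rewrite scale0r add0r subr0.
Qed.

(** Two applications of the mean value theorem: along [u] to the increment [g] of [f] in direction
    [v], then along [v] to [fu]. The left-hand side is symmetric in [u] and [v]. *)
Lemma second_difference f (fu fuv : V -> R) u v z (h : R) : 0 < h ->
  (forall s r, 0 <= s <= h -> 0 <= r <= h ->
    is_derive (s *: u + (r *: v + z)) u f (fu (s *: u + (r *: v + z)))) ->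
  (forall s r, 0 <= s <= h -> 0 <= r <= h ->
    is_derive (s *: u + (r *: v + z)) v fu (fuv (s *: u + (r *: v + z)))) ->
  exists s r, [/\ 0 <= s <= h, 0 <= r <= h &
    f (h *: u + (h *: v + z)) - f (h *: v + z) - (f (h *: u + z) - f z) =
    fuv (s *: u + (r *: v + z)) * h * h].
Proof.
move=> h0 df dfu; have h00 : 0 <= h <= h by rewrite lexx ltW.
have z0h : 0 <= (0 : R) <= h by rewrite lexx ltW.
pose g y : R := f (h *: v + y) - f y.
have shift_derive k (k' : R) (c y w : V) :
    is_derive (c + y) w k k' -> is_derive y w (fun y => k (c + y)) k'.
  apply: (@is_derive_affine R V V k (fun y => c + y) y w w k' _).1 => t.
  by rewrite addrCA.
have [s sh gE] := @MVT_line g (fun y => fu (h *: v + y) - fu y) u z h h0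
  (fun s sh => is_deriveB
    (shift_derive _ _ _ _ _ (eq_ind _ (fun y => is_derive y u f (fu y))
       (df s h sh h00) _ (addrCA _ _ _)))
    (eq_ind _ (fun y => is_derive (s *: u + y) u f (fu (s *: u + y)))
       (df s 0 sh z0h) _ (eq_ind_r (fun y => y + z = z) (add0r z) (scale0r v)))).
have sh' : 0 <= s <= h by move: sh => /andP[s0 s1]; rewrite !ltW.
have [r rh fE] := @MVT_line fu fuv v (s *: u + z) h h0
  (fun r rh => eq_ind _ (fun y => is_derive y v fu (fuv y))
     (dfu s r sh' rh) _ (addrCA _ _ _)).
exists s, r; split=> //; first by move: rh => /andP[r0 r1]; rewrite !ltW.
rewrite (addrCA (s *: u)) -fE -gE /g.
by rewrite [h *: v + (_ + _)]addrCA; ring.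
Qed.

(** The symmetric second difference, divided by [h ^+ 2], is a value of [fuv] at one point near [z]
    and of [fvu] at another. Continuity at [z] brings both within [e / 2] of the values at [z]. *)
Lemma derive_commute f (fu fv fuv fvu : V -> R) u v z (O : set V) :
  nbhs z O ->
  (forall y, O y -> is_derive y u f (fu y)) ->
  (forall y, O y -> is_derive y v f (fv y)) ->
  (forall y, O y -> is_derive y v fu (fuv y)) ->
  (forall y, O y -> is_derive y u fv (fvu y)) ->
  {for z, continuous fuv} -> {for z, continuous fvu} -> fuv z = fvu z.
Proof.
move=> zO dfu dfv dfuv dfvu cuv cvu.
apply/eqP; rewrite -subr_eq0 -normr_le0; apply/ler_addgt0Pr => e e0; rewrite add0r.
have e20 : 0 < e / 2 by rewrite divr_gt0.
have cuv' : \forall y \near z, `|fuv z - fuv y| < e / 2 by move/cvgrPdist_lt: cuv; apply.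
have cvu' : \forall y \near z, `|fvu z - fvu y| < e / 2 by move/cvgrPdist_lt: cvu; apply.
have /nbhs_ballP[m /= m0 Bm] : \forall y \near z,
   [/\ O y, `|fuv z - fuv y| < e / 2 & `|fvu z - fvu y| < e / 2].
  near=> y; split; near: y; by [exact: zO | exact: cuv' | exact: cvu'].
(* Small enough for the parallelogram spanned by [h *: u] and [h *: v] at [z] to fit in the ball of
   radius [m]; the summand 1 covers [u = v = 0]. *)
pose h := m / (2 * (`|u| + `|v| + 1)).
have D0 : 0 < 2 * (`|u| + `|v| + 1) by rewrite mulr_gt0// ltr_wpDl ?addr_ge0.
have h0 : 0 < h by exact: divr_gt0.
have inB s r : 0 <= s <= h -> 0 <= r <= h -> ball z m (s *: u + (r *: v + z)).
  move=> /andP[s0 sh] /andP[r0 rh]; rewrite -ball_normE /ball_ /=.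
  rewrite addrA opprD addrCA subrr addr0 normrN.
  apply: (@le_lt_trans _ _ (h * (`|u| + `|v|))).
    apply: le_trans (ler_normD _ _) _; rewrite !normrZ !ger0_norm// mulrDr.
    by apply: lerD; rewrite ler_wpM2r.
  rewrite /h mulrAC ltr_pdivrMr// ltr_pM2l//.
  by have := normr_ge0 u; have := normr_ge0 v; lra.
have [s [r [sh rh E1]]] := @second_difference f fu fuv u v z h h0
  (fun s r sh rh => dfu _ (let: And3 H _ _ := Bm _ (inB s r sh rh) in H))
  (fun s r sh rh => dfuv _ (let: And3 H _ _ := Bm _ (inB s r sh rh) in H)).
have inB' s' r' : 0 <= s' <= h -> 0 <= r' <= h -> O (s' *: v + (r' *: u + z)).
  by move=> sh' rh'; rewrite addrCA; have [] := Bm _ (inB r' s' rh' sh').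
have [s' [r' [sh' rh' E2]]] := @second_difference f fv fvu v u z h h0
  (fun s r sh rh => dfv _ (inB' s r sh rh))
  (fun s r sh rh => dfvu _ (inB' s r sh rh)).
have [_ P1 _] := Bm _ (inB s r sh rh).
have [_ _ P2] := Bm _ (inB r' s' rh' sh').
have E : fuv (s *: u + (r *: v + z)) = fvu (s' *: v + (r' *: u + z)).
  apply: (mulIf (lt0r_neq0 h0)); apply: (mulIf (lt0r_neq0 h0)).
  by rewrite -E1 -E2 [h *: v + (_ + _)]addrCA; ring.
rewrite addrCA -E in P2.
rewrite [e]splitr (le_trans (ler_distD (fuv (s *: u + (r *: v + z))) _ _))//.
by rewrite lerD// ltW// distrC.
Unshelve. all: by end_near. Qed.

End Schwarz.

(** * Uniform stability of the wave equation *)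

Section SmoothFacts.
Variables (R : realType) (n : nat) (X : domain R n) (f : 'rV[R]_n -> R).
Hypothesis f_smooth : smooth X f.

Lemma smooth_is_derive s i z : inner X z ->
  is_derive z (delta_mx 0 i) (partials s f) (partials (i :: s) f z).
Proof.
by move=> Xz; apply/derivableP; have [_ /(_ s)[dsf _]] := f_smooth; exact: dsf.
Qed.

Lemma smooth_continuous s z : inner X z -> {for z, continuous (partials s f)}.
Proof.
move=> Xz; have [_ /(_ s)[_ [g gc gE]]] := f_smooth.
have /continuous_subspaceW/(_ gc) := @inner_sub _ _ X.
rewrite continuous_open_subspace; last exact: inner_open.
move=> /(_ z (mem_set Xz)) gz.
have gzE := gE z Xz; rewrite /prop_for /continuous_at -gzE; apply: cvg_trans gz.
apply: (@near_eq_cvg _ _ (nbhs z)); near=> y; apply: gE; near: y; exact: inner_near.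
Unshelve. all: by end_near. Qed.

Lemma smooth_commute s i j z : inner X z ->
  partials (i :: j :: s) f z = partials (j :: i :: s) f z.
Proof.
move=> Xz; apply: (@derive_commute _ _ (partials s f)
  (partials (j :: s) f) (partials (i :: s) f) _ _
  (delta_mx 0 j) (delta_mx 0 i) z (inner X)).
- exact: inner_near.
- by move=> y; exact: smooth_is_derive.
- by move=> y; exact: smooth_is_derive.
- by move=> y; exact: (smooth_is_derive (j :: s)).
- by move=> y; exact: (smooth_is_derive (i :: s)).
- exact: smooth_continuous.
- exact: smooth_continuous.
Qed.

Lemma smooth_ext_inner s z : inner X z -> ext X (partials s f) z = partials s f z.
Proof.
move=> Xz; have [_ /(_ s)[_ [g gc gE]]] := f_smooth.
by rewrite (extE gc gE) ?gE//; exact: inner_sub.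
Qed.

Lemma smooth_ext_continuous s : {within X, continuous (ext X (partials s f))}.
Proof.
have [_ /(_ s)[_ [g gc gE]]] := f_smooth.
have extg y : carrier X y -> g y = ext X (partials s f) y.
  by move=> Xy; rewrite (extE gc gE).
apply: subspace_eq_continuous gc => y /set_mem; exact: extg.
Qed.

Lemma smooth_ext0 z : carrier X z -> ext X f z = f z.
Proof. by have [fc _] := f_smooth; exact: extE. Qed.

End SmoothFacts.

(** The coordinates are changed one at a time, each by the mean value theorem; the intermediate
    points mix coordinates of [x] and [y] and so remain in the box. This explains the sum of
    coordinate distances. *)
Lemma lipschitz_box (R : realType) (L M : R) d (f : 'rV[R]_d -> R)
    (f' : 'I_d -> 'rV[R]_d -> R) :
  (forall j x, box L x -> is_derive x (delta_mx 0 j) f (f' j x)) ->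
  (forall j x, box L x -> `|f' j x| <= M) ->
  forall x y, box L x -> box L y ->
    `|f x - f y| <= M * \sum_j `|x 0 j - y 0 j|.
Proof.
elim: d f f' => [|d IHd] f f' df f'M x y xL yL.
  by rewrite (_ : x = y) ?subrr ?normr0 ?big_ord0 ?mulr0//; apply/rowP => -[].
have splitE (z : 'rV[R]_(1 + d)) : z = point (time_of z) (space_of z).
  by rewrite pointK.
have boxP t (z : 'rV[R]_d) : `|t| <= L -> box L z ->
    box L (point t z : 'rV[R]_(1 + d)).
  by move=> tL; apply: box_point; rewrite /= in_itv /= -ler_norml.
have spaceL (z : 'rV[R]_(1 + d)) : box L z -> box L (space_of z).
  by move=> zL j; rewrite space_ofE; exact: zL.
have timeL (z : 'rV[R]_(1 + d)) : box L z -> `|time_of z| <= L.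
  by move=> zL; exact: zL.
set t := time_of (x : 'rV_(1 + d)); set t' := time_of (y : 'rV_(1 + d)).
rewrite [X in f X - _]splitE -/t [X in _ - f X]splitE -/t'.
rewrite (@big_split_ord _ _ _ 1 d) /= big_ord1.
apply: le_trans (ler_distD (f (point t' (space_of (x : 'rV_(1 + d))))) _ _) _.
rewrite mulrDr; apply: lerD; last first.
  under eq_bigr do rewrite -!space_ofE.
  apply: (IHd (fun z => f (point t' z)) (fun j z => f' (sdir j) (point t' z))).
  - move=> j z zL; apply: is_derive_space; apply: df.
    by apply: boxP => //; exact: timeL yL.
  - by move=> j z zL; apply: f'M; apply: boxP => //; exact: timeL yL.
  - exact: spaceL.
  - exact: spaceL.
rewrite -/(time_of (x : 'rV_(1 + d))) -/(time_of (y : 'rV_(1 + d))) -/t -/t'.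
have := timeL _ xL; have := timeL _ yL; rewrite -/t -/t'.
move: (space_of (x : 'rV_(1 + d))) (spaceL _ xL) => z zL.
clear xL yL; clearbody t t'; clear x y.
wlog tt' : t t' / t <= t'.
  move=> wl tL t'L; have [/wl|/ltW/wl] := leP t t'; first exact.
  by rewrite distrC [`|t - _|]distrC; exact.
move=> t'L tL.
have betw r : t <= r <= t' -> box L (point r z : 'rV[R]_(1 + d)).
  move=> /andP[tr rt']; apply: boxP => //.
  by move: tL t'L; rewrite !ler_norml => /andP[? ?] /andP[? ?]; apply/andP; split; lra.
have dft r : t <= r <= t' ->
    is_derive r (1 : R) (fun r => f (point r z)) (f' (tdir d) (point r z)).
  by move=> rt; apply: is_derive_time; apply: df; exact: betw.
have [r|r|r rt E] := @MVT_segment R (fun r => f (point r z))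
  (fun r => f' (tdir d) (point r z)) t t' tt'.
- by rewrite in_itv /= => /andP[? ?]; apply: dft; rewrite !ltW.
- apply: derivable_within_continuous => {}r; rewrite in_itv /= => rt.
  by have [] := dft r rt.
rewrite distrC E normrM distrC ler_wpM2r//; apply: f'M; apply: betw.
by move: rt; rewrite in_itv.
Qed.

Section TimeLines.
Variables (R : realType) (d : nat) (T : R).

Lemma within_time_continuous (g : 'rV[R]_(1 + d) -> R) x :
  {within closed_slab T, continuous g} ->
  {within `[0, T], continuous (fun t => g (point t x))}.
Proof.
move=> /subspace_continuousP gc; apply/subspace_continuousP => t tT B /= nB.
have /gc/(_ B nB) : closed_slab T (point t x).
  by move: tT; rewrite /closed_slab /= time_of_point in_itv.
rewrite !nbhs_simpl /within /= => nB'.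
have pc : {for t, continuous (fun t => point t x)}.
  by apply: continuous_point; [exact: cvg_id | exact: cst_continuous].
have := pc _ nB'; rewrite !nbhs_simpl /=; apply: filterS => r /= rB rT; apply: rB.
by move: rT; rewrite /closed_slab /= time_of_point in_itv.
Qed.

(** The mean value theorem needs the derivative only at interior times, and continuity of [g] up to
    the boundary permits [s = 0], which is how initial data enter. *)
Lemma time_increment (g g' : 'rV[R]_(1 + d) -> R) x (M s t : R) :
  {within closed_slab T, continuous g} ->
  (forall z, open_slab T z -> is_derive z (delta_mx 0 (tdir d)) g (g' z)) ->
  (forall r, 0 < r < T -> `|g' (point r x)| <= M) ->
  0 <= s -> s <= t -> t <= T -> `|g (point t x) - g (point s x)| <= M * (t - s).
Proof.
move=> gc dg g'M s0; rewrite le_eqVlt => /predU1P[-> _|st tT].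
  by rewrite !subrr normr0 mulr0.
have [||r rst ->] := @MVT R (fun t => g (point t x)) (fun t => g' (point t x)) s t st.
- move=> r; rewrite in_itv /= => /andP[sr rt]; apply: is_derive_time; apply: dg.
  by rewrite /open_slab /= time_of_point; apply/andP; split; lra.
- apply: continuous_subspaceW (within_time_continuous gc) => r.
  by rewrite /= !in_itv /= => /andP[? ?]; apply/andP; split; lra.
have ts0 : 0 < t - s by rewrite subr_gt0.
rewrite normrM (gtr0_norm ts0) ler_wpM2r ?(ltW ts0)//.
by apply: g'M; move: rst; rewrite in_itv /= => /andP[? ?]; apply/andP; split; lra.
Qed.

End TimeLines.

(** * Estimates for one function with small Cauchy data and small wave operator *)

Section WaveEstimate.
Variables (R : realType) (d : nat) (T : R) (T_gt0 : 0 < T) (A M eta : R).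
Local Notation X := (slab d T_gt0).
Local Notation st := 'rV[R]_(1 + d).
(** The unit margin keeps a segment of length [Num.sqrt eta <= 1] issued from [box A] inside the
    box, and puts the faces of the box outside the cone. *)
Local Notation L := (A + 1).
Variable w : st -> R.
Hypotheses (TA : T < A) (M_ge0 : 0 <= M) (eta01 : 0 < eta <= 1).
Hypotheses (w_smooth : smooth X w)
  (w_le : forall s z, (size s <= 2)%N -> open_slab T z -> box L (space_of z) ->
    `|partials s w z| <= M)
  (wave_le : forall z, open_slab T z -> box L (space_of z) ->
    `|partials [:: tdir d; tdir d] w z -
      \sum_j partials [:: sdir j; sdir j] w z| <= eta)
  (w_init : forall x, box L x -> `|w (point 0 x)| <= eta)
  (wt_init : forall x, box L x ->
    `|ext X (partials [:: tdir d] w) (point 0 x)| <= eta).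

Let A_gt0 : 0 < A. Proof. exact: lt_trans TA. Qed.
Let L_gt0 : 0 < L. Proof. by have A0 := A_gt0; lra. Qed.
Let boxAL (x : 'rV[R]_d) : box A x -> box L x.
Proof. by move=> xA j; have := xA j; lra. Qed.

Let point_slab s (x : 'rV[R]_d) : 0 < s < T -> open_slab T (point s x : st).
Proof. by rewrite /open_slab /= time_of_point. Qed.

Let w_le_point l s x : (size l <= 2)%N -> 0 < s < T -> box L x ->
  `|partials l w (point s x)| <= M.
Proof.
by move=> l2 sT xL; apply: w_le => //; [exact: point_slab | rewrite space_of_point].
Qed.

Lemma wave_value_le s x (c : R) : 0 <= s <= T -> box L x -> 0 <= c ->
  (forall r, 0 < r < T -> `|partials [:: tdir d] w (point r x)| <= c) ->
  `|w (point s x)| <= eta + c * s.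
Proof.
move=> /andP[s0 sT] xL c0 wc; have [wcont _] := w_smooth.
have := @time_increment R d T w (partials [:: tdir d] w) x c 0 s wcont
  (fun z zT => smooth_is_derive w_smooth [::] (tdir d) zT) wc (lexx 0) s0 sT.
rewrite subr0 => H.
rewrite -[w _](subrK (w (point 0 x))) addrC.
by apply: le_trans (ler_normD _ _) (lerD _ H); exact: w_init.
Qed.

(** The continuous extension of [w_t] is at most [eta] at time 0 and changes at rate at most [M],
    over a time of at most [eta]. *)
Let wt_early s x : 0 < s < T -> s <= eta -> box L x ->
  `|partials [:: tdir d] w (point s x)| <= (1 + M) * eta.
Proof.
move=> s0T seta xL; have /andP[s0 sT] := s0T.
have dext z : open_slab T z -> is_derive z (delta_mx 0 (tdir d))
    (ext X (partials [:: tdir d] w)) (partials [:: tdir d; tdir d] w z).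
  move=> zT; apply: near_eq_is_derive
    (smooth_is_derive w_smooth [:: tdir d] (tdir d) zT).
  near=> y; rewrite smooth_ext_inner//; near: y.
  exact: (inner_near (X := X)).
have := @time_increment R d T (ext X (partials [:: tdir d] w)) _ x M 0 s
  (smooth_ext_continuous w_smooth (s := [:: tdir d])) dext
  (fun r rT => @w_le_point [:: tdir d; tdir d] r x isT rT xL)
  (lexx 0) (ltW s0) (ltW sT).
rewrite subr0 => H.
rewrite -(smooth_ext_inner w_smooth [:: tdir d]); last exact: point_slab.
set a := ext _ _ _ in H *.
rewrite -[a](subrK (ext X (partials [:: tdir d] w) (point 0 x))) addrC.
apply: le_trans (ler_normD _ _) _.
rewrite mulrDl mul1r; apply: lerD; first exact: wt_init.
by apply: le_trans H _; rewrite ler_wpM2l.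
Unshelve. all: by end_near. Qed.

(* A difference quotient of step [sqrt eta] controls the space derivatives
   near [t = 0] by the size of [w] and of its second derivatives. *)
Let wx_early s x j : 0 < s < T -> s <= eta -> box A x ->
  `|partials [:: sdir j] w (point s x)| <= (2 + 3 * M) * Num.sqrt eta.
Proof.
move=> sT seta xA; have /andP[eta0 eta1] := eta01.
have M0 := M_ge0; have /andP[s0 sT'] := sT.
set k := Num.sqrt eta.
have k0 : 0 < k by rewrite sqrtr_gt0.
have kk : k ^+ 2 = eta by rewrite sqr_sqrtr// ltW.
have k1 : k <= 1 by move: kk k0; clearbody k; nra.
have lineL r : 0 <= r <= k -> box L (r *: delta_mx 0 j + x).
  move=> /andP[r0 rk] i; rewrite !mxE /=; have := xA i.
  case: (i == j); rewrite ?mulr1 ?mulr0 ?add0r; last by lra.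
  move=> xAi; apply: le_trans (ler_normD _ _) _.
  by rewrite ger0_norm//; lra.
have w_small y : box L y -> `|w (point s y)| <= (1 + M) * eta.
  move=> yL; rewrite mulrDl mul1r.
  apply: le_trans (wave_value_le (c := M) _ yL M0 _) _.
  - by rewrite !ltW.
  - by move=> r rT; exact: (@w_le_point [:: tdir d]).
  - by rewrite lerD2l ler_wpM2l.
have dw l y : is_derive y (delta_mx 0 j) (fun y => partials l w (point s y))
    (partials (sdir j :: l) w (point s y)).
  by apply: is_derive_space; apply: (smooth_is_derive w_smooth); exact: point_slab.
have [r /andP[r0 rk] E1] := MVT_line (f' := fun y => partials [:: sdir j] w (point s y))
  (u := delta_mx 0 j) (y := x) k0
  (fun r _ => dw [::] (r *: delta_mx 0 j + x)).
have [r' /andP[r'0 r'r] E2] := MVT_line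
  (f' := fun y => partials [:: sdir j; sdir j] w (point s y)) (u := delta_mx 0 j) (y := x) r0
  (fun r _ => dw [:: sdir j] (r *: delta_mx 0 j + x)).
set B := partials [:: sdir j] w (point s x) in E2 *.
set B' := partials [:: sdir j] w (point s (r *: delta_mx 0 j + x)) in E1 E2.
(* [B'] is the difference quotient of step [k], at most [2 * (1 + M) * k]; passing from [B'] to [B]
   costs [M * k] more. Hence the constant [2 + 3 * M]. *)
have B'B : `|B' - B| <= M * k.
  rewrite E2 normrM; apply: ler_pM => //; last by rewrite gtr0_norm// ltW.
  apply: w_le_point => //; apply: lineL; apply/andP; split; lra.
have B'k : `|B'| * k <= 2 * (1 + M) * eta.
  rewrite -[k in leLHS](gtr0_norm k0) -normrM -E1.
  apply: le_trans (ler_normB _ _) _.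
  have H1 := w_small _ (lineL k _); have H2 := w_small _ (boxAL xA).
  by have := H1 _; rewrite lexx ltW// => /(_ isT) {}H1; lra.
have B'2 : `|B'| <= 2 * (1 + M) * k.
  have E : 2 * (1 + M) * k * k = 2 * (1 + M) * k ^+ 2 by ring.
  by rewrite -(ler_pM2r k0) E kk.
rewrite -[B](subKr B'); apply: le_trans (ler_normB _ _) _.
rewrite /partials /= in B'B B'2 *.
by nra.
Qed.

Let dens := energy_density (partials [:: tdir d] w)
  (fun j => partials [:: sdir j] w).
Let en := energy A L (partials [:: tdir d] w) (fun j => partials [:: sdir j] w).

(** [A ^+ 4] bounds the cutoff and the power of [2 * L] is the volume of the box. Between them stand
    the [d + 1] squared first derivatives in the initial layer and the growth caused by the wave
    operator up to time [T]. *)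
Definition energy_const : R :=
  A ^+ 4 * ((2 + 3 * M) ^+ 2 *+ d.+1 + 2 * M * T) * (2 * L) ^+ d.

Let energy_early s : 0 < s < T -> s <= eta ->
  en s <= A ^+ 4 * ((2 + 3 * M) ^+ 2 *+ d.+1 * eta) * (2 * L) ^+ d.
Proof.
move=> sT seta; have /andP[eta0 eta1] := eta01; have M0 := M_ge0.
have TA' := TA; have /andP[s0 sT'] := sT.
apply: le_trans (ler_norm _) _; apply: box_integral_bound => //.
  by rewrite mulr_ge0 ?exprn_ge0 ?(ltW A_gt0)// mulr_ge0 ?(ltW eta0)//
      mulrn_wge0 ?sqr_ge0.
move=> x xL; have [xA|xA] := pselect (box A x); last first.
  have /existsNP[j /negP] := xA; rewrite -ltNge => Axj.
  rewrite (@cutoff_out _ _ _ _ j) ?mul0r ?normr0.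
    by rewrite mulr_ge0 ?exprn_ge0 ?(ltW A_gt0)// mulr_ge0 ?(ltW eta0)//
      mulrn_wge0 ?sqr_ge0.
  by rewrite point_sdir time_of_point ger0_norm; lra.
have dens0 z : 0 <= dens z.
  by rewrite addr_ge0 ?sqr_ge0//; apply: sumr_ge0 => j _; exact: sqr_ge0.
rewrite ger0_norm; last by apply: mulr_ge0; [exact: cutoff_ge0 | exact: dens0].
apply: ler_pM; [exact: cutoff_ge0 | exact: dens0 | |].
  by apply: cutoff_le; rewrite time_of_point; apply/andP; split; lra.
have sq (a : R) : `|a| <= (2 + 3 * M) * Num.sqrt eta ->
    a ^+ 2 <= (2 + 3 * M) ^+ 2 * eta.
  move=> aM; rewrite -[a ^+ 2]real_normK ?num_real//.
  have -> : (2 + 3 * M) ^+ 2 * eta = ((2 + 3 * M) * Num.sqrt eta) ^+ 2.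
    by rewrite exprMn sqr_sqrtr// ltW.
  by rewrite lerXn2r// nnegrE mulr_ge0 ?sqrtr_ge0//; lra.
have -> : (2 + 3 * M) ^+ 2 *+ d.+1 * eta =
    (2 + 3 * M) ^+ 2 * eta + (2 + 3 * M) ^+ 2 * eta *+ d.
  by rewrite mulrnAl mulrS.
rewrite /energy_density; apply: lerD.
  apply: sq; apply: le_trans (wt_early sT seta (boxAL xA)) _.
  have : eta <= Num.sqrt eta.
    have := sqr_sqrtr (ltW eta0); have : 0 <= Num.sqrt eta by exact: sqrtr_ge0.
    by move: (Num.sqrt eta) => k k0 kk; nra.
  have := sqrtr_ge0 eta; move: (Num.sqrt eta) => k k0; nra.
have -> : (2 + 3 * M) ^+ 2 * eta *+ d = \sum_(j < d) ((2 + 3 * M) ^+ 2 * eta).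
  by rewrite sumr_const card_ord.
by apply: ler_sum => j _; apply: sq; exact: wx_early.
Qed.

Lemma wave_energy_le t : 0 < t < T -> en t <= energy_const * eta.
Proof.
move=> /andP[t0 tT]; have /andP[eta0 eta1] := eta01; have M0 := M_ge0.
have A0 := A_gt0; have L0 := L_gt0.
(* A starting time inside the initial layer and not after [t]. *)
pose s := Num.min t eta / 2.
have [s0 st seta] : [/\ 0 < s, s <= t & s <= eta].
  by rewrite /s; have [|] := leP t eta; split; lra.
have := @energy_le R d T A L M eta (partials [:: tdir d] w)
  (partials [:: tdir d; tdir d] w) (fun j => partials [:: sdir j] w)
  (fun j => partials [:: sdir j; tdir d] w)
  (fun j => partials [:: sdir j; sdir j] w) TA _
  _ _ _ _ _ _ _ _ _ _ _ s t s0 st tT.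
rewrite -/en => /(_ _ _ _ _ _ _ _ _ _ _ _ _)/le_trans; apply.
- by lra.
- by move=> z; exact: (smooth_continuous w_smooth).
- by move=> z; exact: (smooth_continuous w_smooth).
- by move=> j z; exact: (smooth_continuous w_smooth).
- by move=> j z; exact: (smooth_continuous w_smooth).
- by move=> j z; exact: (smooth_continuous w_smooth).
- by move=> z; exact: (smooth_is_derive w_smooth [:: tdir d]).
- by move=> j z; exact: (smooth_is_derive w_smooth [:: tdir d]).
(* The energy inequality uses one function both as the space derivative of [w_t] and as the time
   derivative of the gradient: Schwarz's theorem. *)
- move=> j z zT; rewrite (smooth_commute w_smooth) //.
  exact: (smooth_is_derive w_smooth [:: sdir j]).
- by move=> j z; exact: (smooth_is_derive w_smooth [:: sdir j]).
- by move=> z zT zL; apply: w_le.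
- exact: wave_le.
have s0T : 0 < s < T by apply/andP; split => //; lra.
apply: le_trans (lerD (energy_early s0T seta) (lexx _)) _.
rewrite /energy_const; set K := _ *+ _.
have -> : A ^+ 4 * (K + 2 * M * T) * (2 * L) ^+ d * eta =
  A ^+ 4 * (K * eta) * (2 * L) ^+ d + 2 * A ^+ 4 * M * eta * (2 * L) ^+ d * T.
  by ring.
rewrite lerD2l ler_wpM2l//; last by lra.
rewrite !mulr_ge0 ?exprn_ge0 ?(ltW eta0) ?(ltW A0)//; lra.
Qed.

(* If [w_t] were larger than [delta] at a point, the Lipschitz bound would
   keep it above [delta / 2] on a cube of side [2 k], which the energy forbids. *)
Lemma wave_dt_le (rho delta k : R) t x : 0 < delta -> 0 < k <= 1 ->
  0 <= rho -> T + (rho + 1) *+ d.+1 + 1 <= A -> M * (k *+ d) <= delta / 2 ->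
  energy_const * eta < (delta / 2) ^+ 2 * (2 * k) ^+ d ->
  0 < t < T -> box rho x -> `|partials [:: tdir d] w (point t x)| <= delta.
Proof.
move=> delta0 /andP[k0 k1] rho0 rhoA Mk small tT xrho.
have /andP[t0 tT'] := tT; have L0 := L_gt0; have A0 := A_gt0.
rewrite leNgt; apply/negP => big.
suff : (delta / 2) ^+ 2 * (2 * k) ^+ d <= en t.
  by move=> /le_trans/(_ (wave_energy_le tT)); rewrite leNgt small.
have rho1 : (rho + 1) <= (rho + 1) *+ d.+1.
  by rewrite mulrS lerDl mulrn_wge0//; lra.
have nearL (y : 'rV[R]_d) : (forall j, `|y 0 j - x 0 j| <= k) ->
    box (rho + 1) y.
  move=> yx j; rewrite -[y 0 j](subrK (x 0 j)).
  by apply: le_trans (ler_normD _ _) _; have := yx j; have := xrho j; lra.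
have boxL y : box (rho + 1) y -> box L y.
  by move=> yr j; have := yr j; have := t0; lra.
apply: (box_integral_ge_cube L0 (x0 := x)).
- move=> y; apply: (@continuous_mul _ _ (fun y => cutoff A (point t y))
    (fun y => dens (point t y))).
    apply: (@continuous_slice _ _ (fun z => cutoff A z)).
    exact: continuous_cutoff.
  apply: (@continuous_slice _ _ dens).
  have yT := point_slab y tT.
  apply: (@continuous_add _ _ (fun z => partials [:: tdir d] w z ^+ 2)
     (fun z => \sum_j partials [:: sdir j] w z ^+ 2)).
    exact/continuous_sqr/(smooth_continuous w_smooth).
  apply: continuous_bigsum => j.
  exact/continuous_sqr/(smooth_continuous w_smooth).
- exact: ltW.
- exact: sqr_ge0.
- by move=> j; have := xrho j; lra.
- move=> y _; rewrite mulr_ge0 ?cutoff_ge0// addr_ge0 ?sqr_ge0//.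
  by apply: sumr_ge0 => j _; exact: sqr_ge0.
move=> y yx; have yr := nearL _ yx.
(* The cutoff is at least 1 on the cube: with [D = (rho + 1) *+ d.+1], the point satisfies
   [|y| <= D] while [A - t >= D + 1], so [cone] is at least [2 * D + 1]. *)
rewrite -[leLHS]mul1r; apply: ler_pM => //; first exact: sqr_ge0.
  rewrite /cutoff /pos_sqr expr_ge1 ?le_max ?lexx ?orbT// /cone time_of_point.
  apply/orP; left.
  have S : \sum_j (point t y : st) 0 (sdir j) ^+ 2 <= (rho + 1) ^+ 2 *+ d.
    rewrite -[X in _ *+ X]card_ord -sumr_const; apply: ler_sum => j _.
    rewrite point_sdir -[leLHS]real_normK ?num_real//.
    by rewrite lerXn2r ?nnegrE ?yr//; lra.
  have S2 : (rho + 1) ^+ 2 *+ d <= ((rho + 1) *+ d.+1) ^+ 2.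
    rewrite -[in leRHS]mulr_natr exprMn -[leLHS]mulr_natr ler_wpM2l ?sqr_ge0//.
    by rewrite -natrX ler_nat (leq_trans (leqnSn d))// expnS expn1 leq_pmull.
  have D0 : 0 <= (rho + 1) *+ d.+1 by lra.
  move: S S2 D0 rhoA; set D := _ *+ d.+1 => S S2 D0 rhoA.
  have : (D + 1) ^+ 2 <= (A - t) ^+ 2 by rewrite lerXn2r ?nnegrE//; lra.
  by nra.
rewrite -[leLHS]addr0; apply: lerD; last first.
  by apply: sumr_ge0 => j _; exact: sqr_ge0.
rewrite -[leRHS]real_normK ?num_real// lerXn2r ?nnegrE//; first by lra.
have : `|partials [:: tdir d] w (point t x) - partials [:: tdir d] w (point t y)|
    <= delta / 2.
  apply: le_trans (le_trans (_ : _ <= M * \sum_j `|x 0 j - y 0 j|) _) Mk.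
    apply: (@lipschitz_box R L M d (fun y => partials [:: tdir d] w (point t y))
      (fun j y => partials [:: sdir j; tdir d] w (point t y))).
    - move=> j z zL; apply: is_derive_space.
      by apply: (smooth_is_derive w_smooth [:: tdir d]); exact: point_slab.
    - by move=> j z zL; exact: w_le_point.
    - by move=> j; have := xrho j; lra.
    - exact: boxL.
  rewrite ler_wpM2l// -[X in _ *+ X]card_ord -sumr_const.
  by apply: ler_sum => j _; rewrite distrC.
move: big; set a := partials _ _ _; set b := partials _ _ _ => big ab.
have : `|a| <= `|a - b| + `|b| by rewrite -{1}[a](subrK b) ler_normD.
by lra.
Qed.

End WaveEstimate.

(** The order of the quantifiers matters: the box size [L] is fixed before [M], so that for a net
    the uniform bound [M] can be taken on that box, and [eta] is chosen last, independently of
    [w]. *)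
Lemma wave_stability (R : realType) (d : nat) (T : R) (T_gt0 : 0 < T) (rho : R) :
  0 <= rho -> exists2 L : R, 0 < L & forall M delta : R, 0 <= M -> 0 < delta ->
  exists2 eta : R, 0 < eta & forall w : 'rV[R]_(1 + d) -> R,
  smooth (slab d T_gt0) w ->
  (forall s z, (size s <= 2)%N -> open_slab T z -> box L (space_of z) ->
    `|partials s w z| <= M) ->
  (forall z, open_slab T z -> box L (space_of z) ->
    `|partials [:: tdir d; tdir d] w z -
      \sum_j partials [:: sdir j; sdir j] w z| <= eta) ->
  (forall x, box L x -> `|w (point 0 x)| <= eta) ->
  (forall x, box L x ->
    `|ext (slab d T_gt0) (partials [:: tdir d] w) (point 0 x)| <= eta) ->
  forall t x, 0 <= t <= T -> box rho x -> `|w (point t x)| <= delta.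
Proof.
move=> rho0; pose A := T + (rho + 1) *+ d.+1 + 1.
have rho1 : rho + 1 <= (rho + 1) *+ d.+1.
  by rewrite mulrS lerDl mulrn_wge0//; lra.
have TA : T < A by rewrite /A; lra.
have rhoA : rho <= A + 1 by rewrite /A; lra.
exists (A + 1) => [|M delta M0 delta0]; first by lra.
(* A time derivative of this size contributes at most [delta / 2] to [w] over a time [T]; the
   initial value contributes the other half. *)
pose delta1 := delta / (2 * T).
have delta10 : 0 < delta1 by rewrite divr_gt0// mulr_gt0.
have Md0 : 0 <= M * d%:R by rewrite mulr_ge0.
(* Side of the cube over which the Lipschitz bound lets [w_t] drop by at most [delta1 / 2]; the
   summand 1 avoids a zero denominator. *)
pose k := Num.min 1 (delta1 / (2 * (M * d%:R + 1))).
have k0 : 0 < k by rewrite lt_min ltr01/= divr_gt0// mulr_gt0//; lra.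
have k1 : k <= 1 by rewrite ge_min lexx.
have Mk : M * (k *+ d) <= delta1 / 2.
  have kD : k * (2 * (M * d%:R + 1)) <= delta1.
    by rewrite -ler_pdivlMr ?ge_min ?lexx ?orbT// mulr_gt0//; lra.
  have -> : M * (k *+ d) = k * (M * d%:R) by rewrite -[k *+ d]mulr_natr mulrCA.
  by move: (M * d%:R) Md0 kD => D D0 kD; nra.
pose c := (delta1 / 2) ^+ 2 * (2 * k) ^+ d.
have c0 : 0 < c by rewrite mulr_gt0// exprn_gt0// ?divr_gt0// mulr_gt0.
pose E := energy_const d T A M.
have E0 : 0 <= E.
  rewrite /E /energy_const !mulr_ge0 ?exprn_ge0// ?addr_ge0 ?mulrn_wge0 ?sqr_ge0//;
    rewrite ?mulr_ge0//; lra.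
(* The last entry pushes the energy bound [E * eta] below [c], the energy that a too large [w_t]
   would force on the cube. *)
pose eta := Num.min (Num.min 1 (delta / 2)) (c / (E + 1)).
have eta0 : 0 < eta by rewrite !lt_min ltr01 !divr_gt0//; lra.
have eta1 : eta <= 1 by rewrite !ge_min lexx.
have etad : eta <= delta / 2 by rewrite !ge_min lexx !orbT.
have small : E * eta < c.
  have : eta * (E + 1) <= c by rewrite -ler_pdivlMr ?ge_min ?lexx ?orbT//; lra.
  by move: eta eta0 {eta1 etad} => e e0; nra.
exists eta => // w ws wM wbox w0 wt0 t x tT xrho.
have eta01 : 0 < eta <= 1 by rewrite eta0.
have k01 : 0 < k <= 1 by rewrite k0.
have xL : box (A + 1) x by move=> j; exact: le_trans (xrho j) rhoA.
have wt r : 0 < r < T -> `|partials [:: tdir d] w (point r x)| <= delta1.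
  move=> rT; exact: (wave_dt_le TA M0 eta01 ws wM wbox w0 wt0 delta10 k01 rho0
    (lexx _) Mk small rT xrho).
apply: le_trans (wave_value_le ws w0 tT xL (ltW delta10) wt) _.
have d1T : delta1 * T = delta / 2 by rewrite /delta1; field; rewrite lt0r_neq0.
have : delta1 * t <= delta1 * T by rewrite ler_pM2l//; case/andP: tT.
by lra.
Qed.

(** * Representatives of generalized functions *)

Section Representatives.
Variables (R : realType) (n : nat) (X : domain R n).
Implicit Types (u v : net R n) (U V : gen_fun X) (K : set 'rV[R]_n).

Lemma ext_le_seminorm K s u eps x : smooth X (u eps) -> compact K ->
  K `<=` X -> K x -> `|ext X (partials s (u eps)) x| <= seminorm X K s u eps.
Proof.
by move=> su cK KX Kx; apply: ub_le_sup; [exact: ext_has_ubound | exists x].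
Qed.

Lemma near_eps01 : \forall eps \near (0 : R)^'+, 0 < eps <= 1.
Proof.
near=> eps; apply/andP; split; near: eps.
  exact: nbhs_right_gt.
exact: nbhs_right_le.
Unshelve. all: by end_near. Qed.

Lemma negligible_le u K s (delta : R) : negligible X u -> compact K ->
  K `<=` X -> 0 < delta ->
  \forall eps \near 0^'+, forall x, K x ->
    `|ext X (partials s (u eps)) x| <= delta.
Proof.
move=> [su nu] cK KX delta0.
have /eqO_exP[k k0 uk] := nu K s cK KX 1 ler01.
near=> eps; have e01 : 0 < eps <= 1 by near: eps; exact: near_eps01.
have /andP[e0 _] := e01.
move=> x Kx; apply: le_trans (ext_le_seminorm s (su _ e01) cK KX Kx) _.
apply: le_trans (ler_norm _) _.
apply: (@le_trans _ _ (k * `|eps `^ 1|)); first by near: eps; exact: uk.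
rewrite powRr1 ?(ltW e0)// gtr0_norm// mulrC -ler_pdivlMr//.
by near: eps; apply: nbhs_right_le; exact: divr_gt0.
Unshelve. all: by end_near. Qed.

Lemma negligible_value_le u K (delta : R) : negligible X u -> compact K ->
  K `<=` X -> 0 < delta ->
  \forall eps \near 0^'+, forall x, K x -> `|u eps x| <= delta.
Proof.
move=> nu cK KX delta0; have [su _] := nu.
near=> eps; have e01 : 0 < eps <= 1 by near: eps; exact: near_eps01.
move=> x Kx; rewrite -(smooth_ext0 (su _ e01) (KX _ Kx)).
by move: x Kx; near: eps; exact: (negligible_le [::]).
Unshelve. all: by end_near. Qed.

Lemma grepr_negligible u U : gclass X u = U -> negligible X (u - grepr U).
Proof. by move=> uU; apply/gclassP; rewrite greprK. Qed.

Lemma smooth_net_repr u U : gclass X u = U -> smooth_net X u ->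
  smooth_net X (grepr U).
Proof.
move=> /grepr_negligible[sn _] su eps e01.
have -> : grepr U eps = u eps - (u - grepr U) eps.
  by apply/funext => x /=; rewrite subKr.
by apply: smoothB; [exact: su | exact: sn].
Qed.

Lemma colombeau0_smooth U : colombeau0 U -> smooth_net X (grepr U).
Proof. by move=> [_ [u [su _] uU]]; exact: smooth_net_repr su. Qed.

(** The representative of bounded type need not be the one selected by [grepr]. The two differ by a
    negligible net, whose derivatives are eventually at most 1 on [K]; hence [k + 1]. *)
Lemma colombeau0_bounded U K s : colombeau0 U -> compact K -> K `<=` X ->
  exists2 C : R, 0 <= C & \forall eps \near 0^'+, forall x, K x ->
    `|ext X (partials s (grepr U eps)) x| <= C.
Proof.
move=> [_ [u [su bu] uU]] cK KX.
have sr := smooth_net_repr uU su; have nu := grepr_negligible uU.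
have nuK := negligible_le s nu cK KX ltr01.
have /eqO_exP[k k0 uk] := bu K s cK KX.
exists (k + 1) => [|]; first by rewrite addr_ge0// ltW.
near=> eps; have e01 : 0 < eps <= 1 by near: eps; exact: near_eps01.
move=> x Kx.
have -> : grepr U eps = u eps - (u - grepr U) eps.
  by apply/funext => y /=; rewrite subKr.
rewrite extB; [|exact: su|by have [sn _] := nu; exact: sn|exact: KX].
apply: le_trans (ler_normB _ _) _; apply: lerD.
  apply: le_trans (ext_le_seminorm s (su _ e01) cK KX Kx) _.
  apply: le_trans (ler_norm _) _.
  rewrite -[k]mulr1 -[X in k * X]normr1; near: eps; exact: uk.
by move: x Kx; near: eps; exact: nuK.
Unshelve. all: by end_near. Qed.

Lemma partials_ext (f : 'rV[R]_n -> R) s l z : smooth X f -> inner X z ->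
  partials l (ext X (partials s f)) z = partials (l ++ s) f z.
Proof.
move=> sf; elim: l z => [|i l IHl] z Xz /=; first exact: smooth_ext_inner.
apply: near_eq_derive; have := inner_near Xz.
by apply: filterS => y Xy; exact: IHl.
Qed.

Lemma smooth_ext (f : 'rV[R]_n -> R) s : smooth X f ->
  smooth X (ext X (partials s f)).
Proof.
move=> sf; split=> [|l]; first exact: smooth_ext_continuous.
split=> [i z Xz|].
  apply: (@near_eq_derivable _ _ _ (partials (l ++ s) f)).
    have := inner_near Xz.
    by apply: filterS => y Xy; rewrite partials_ext.
  by have [_ /(_ (l ++ s))[dlf _]] := sf; exact: dlf.
exists (ext X (partials (l ++ s) f)); first exact: smooth_ext_continuous.
by move=> z Xz; rewrite smooth_ext_inner// partials_ext.
Qed.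

Lemma gpartial_negligible i U : negligible X
  ((fun eps => ext X (partials [:: i] (grepr U eps))) - grepr (gpartial i U)).
Proof. exact: grepr_negligible. Qed.

Lemma smooth_net_gpartial i U : smooth_net X (grepr U) ->
  smooth_net X (grepr (gpartial i U)).
Proof.
move=> sU; apply: smooth_net_repr (erefl (gpartial i U)) _ => eps e01.
exact/(smooth_ext [:: i])/sU.
Qed.

Lemma gclass0 : gclass X 0 = 0.
Proof. by rewrite -(subrr (0 : net R n)) gclassB subrr. Qed.

Lemma gclass_sum m (u : 'I_m -> net R n) :
  gclass X (\sum_i u i) = \sum_i gclass X (u i).
Proof.
have gclassD v w : gclass X (v + w) = gclass X v + gclass X w.
  by rewrite -[w in LHS]opprK -(sub0r w) !gclassB gclass0 sub0r opprK.
by elim/big_ind2 : _ => [|u1 ? u2 ? <- <-|]; rewrite ?gclass0 ?gclassD.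
Qed.

End Representatives.

(** * The two wave problems at the level of representatives *)

Section WaveRepresentatives.
Variables (R : realType) (d : nat) (T : R) (T_gt0 : 0 < T).
Local Notation X := (slab d T_gt0).
Implicit Types (U V : gen_fun X) (K : set 'rV[R]_(1 + d)).

(** Applying [gpartial] twice passes through a representative chosen for the inner derivative. The
    resulting error is a derivative of a negligible net. *)
Lemma partials_grepr_gpartial i U eps z : smooth_net X (grepr U) ->
  0 < eps <= 1 -> inner X z ->
  partials [:: i; i] (grepr U eps) z -
    ext X (partials [:: i] (grepr (gpartial i U) eps)) z =
  ext X (partials [:: i] (((fun eps => ext X (partials [:: i] (grepr U eps))) -
    grepr (gpartial i U)) eps)) z.
Proof.
move=> sU e01 Xz; have sp := smooth_net_gpartial i sU e01.
have se := smooth_ext [:: i] (sU _ e01).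
rewrite extB//; last exact: inner_sub.
by rewrite [in RHS]smooth_ext_inner// partials_ext//; exact: sU.
Qed.

Lemma dalembertian_grepr U (g : net R (1 + d)) K (delta : R) :
  smooth_net X (grepr U) -> dalembertian U = gclass X g ->
  compact K -> K `<=` X -> 0 < delta ->
  \forall eps \near 0^'+, forall z, K z -> open_slab T z ->
    `|partials [:: tdir d; tdir d] (grepr U eps) z -
      \sum_j partials [:: sdir j; sdir j] (grepr U eps) z - g eps z| <= delta.
Proof.
move=> sU Ug cK KX delta0.
pose h i : net R (1 + d) :=
  fun eps => ext X (partials [:: i] (grepr (gpartial i U) eps)).
have hg : negligible X (h (tdir d) - \sum_j h (sdir j) - g).
  by apply/gclassP; rewrite gclassB gclass_sum.
(* Half of [delta] is reserved for the equation itself; the other half is shared by the [d + 1]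
   second derivatives, each off by a change of representative. *)
pose delta' := delta / (2 * d.+1%:R).
have d1 : 0 < d.+1%:R :> R by rewrite ltr0n.
have delta'0 : 0 < delta' by rewrite divr_gt0// mulr_gt0.
have nearh : \forall eps \near 0^'+, forall i z, K z -> `|ext X (partials [:: i]
    (((fun eps => ext X (partials [:: i] (grepr U eps))) -
       grepr (gpartial i U)) eps)) z| <= delta'.
  apply: filter_forall => i.
  exact: negligible_le (gpartial_negligible i U) cK KX delta'0.
have nearhg : \forall eps \near 0^'+, forall z, K z ->
    `|(h (tdir d) - \sum_j h (sdir j) - g) eps z| <= delta / 2.
  by apply: (negligible_value_le hg cK KX); exact: divr_gt0.
near=> eps; have e01 : 0 < eps <= 1 by near: eps; exact: near_eps01.
have hle : forall i z, K z -> open_slab T z ->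
    `|partials [:: i; i] (grepr U eps) z - h i eps z| <= delta'.
  move=> i z Kz zT; rewrite /h partials_grepr_gpartial//.
  move: i z Kz {zT}; near: eps; exact: nearh.
have hgle : forall z, K z ->
    `|(h (tdir d) - \sum_j h (sdir j) - g) eps z| <= delta / 2.
  by near: eps.
move=> z Kz zT; have := hgle z Kz.
rewrite (_ : (_ - _ - g) eps z =
    h (tdir d) eps z - \sum_j h (sdir j) eps z - g eps z); last first.
  by congr (_ - _ - _); rewrite fct_sumE fct_sumE.
set S := \sum_j partials _ _ _; set S' := \sum_j h _ _ _.
set a := partials _ _ _; set a' := h _ _ _; set b := g _ _ => H.
have aa' : `|a - a'| <= delta' by exact: hle.
have SS' : `|S - S'| <= delta' * d%:R.
  rewrite /S /S' -sumrB; apply: le_trans (ler_norm_sum _ _ _) _.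
  rewrite mulr_natr -[X in _ *+ X]card_ord -sumr_const.
  by apply: ler_sum => j _; exact: hle.
have -> : a - S - b = (a - a') - (S - S') + (a' - S' - b) by ring.
apply: le_trans (ler_normD _ _) _.
have dE : delta' + delta' * d%:R = delta / 2.
  rewrite /delta' -[d.+1%:R]natr1; field.
  by rewrite natr1 (lt0r_neq0 d1).
have := ler_normB (a - a') (S - S').
lra.
Unshelve. all: by end_near. Qed.

Lemma initial_grepr U V (L delta : R) : initial U = initial V -> 0 < delta ->
  \forall eps \near 0^'+, forall x : 'rV[R]_d, box L x ->
    `|grepr U eps (point 0 x) - grepr V eps (point 0 x)| <= delta.
Proof.
move=> /gclassP UV delta0.
have cL : compact (box L (d := d)).
  rewrite (_ : box L (d := d) = [set v | forall j, `[(- L), L]%classic (v ord0 j)]).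
    by apply: (rV_compact (A := fun=> `[(- L), L]%classic)) => _; exact: segment_compact.
  by apply/seteqP; split=> x xL j; have := xL j; rewrite /= in_itv /= ler_norml.
exact: (negligible_value_le UV cL (fun _ _ => I) delta0).
Qed.

(** One third of [delta] for the equality of the initial classes, and one third for each of the two
    representatives chosen for the time derivatives. *)
Lemma initial_gpartial_grepr U V (L delta : R) :
  smooth_net X (grepr U) -> smooth_net X (grepr V) ->
  initial (gpartial (tdir d) U) = initial (gpartial (tdir d) V) -> 0 < delta ->
  \forall eps \near 0^'+, forall x : 'rV[R]_d, box L x ->
    `|ext X (partials [:: tdir d] (grepr U eps)) (point 0 x) -
      ext X (partials [:: tdir d] (grepr V eps)) (point 0 x)| <= delta.
Proof.
move=> sU sV UV delta0; have delta30 : 0 < delta / 3 by exact: divr_gt0.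
have cK := @cylinder_compact R L d 0 T.
set K := [set z | _] in cK.
have KX : K `<=` X by move=> z [].
have K0 x : box L x -> K (point 0 x).
  by move=> xL; split; rewrite ?time_of_point ?space_of_point// lexx ltW.
have hUV := initial_grepr L UV delta30.
have hU := negligible_value_le (gpartial_negligible (tdir d) U) cK KX delta30.
have hV := negligible_value_le (gpartial_negligible (tdir d) V) cK KX delta30.
apply: filterS3 hUV hU hV => eps H1 H2 H3 x xL.
have {}H1 := H1 x xL; have {}H2 := H2 _ (K0 x xL); have {}H3 := H3 _ (K0 x xL).
have subE (u v : net R (1 + d)) z : (u - v) eps z = u eps z - v eps z by [].
move: H1 H2 H3; rewrite !subE.
move: (ext _ _ _) (ext _ _ _) (grepr _ _ _) (grepr _ _ _) => a b c c'.
rewrite !ler_norml.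
move=> /andP[? ?] /andP[? ?] /andP[? ?]; apply/andP; split; lra.
Qed.

Lemma partials_bounded U V (L : R) : colombeau0 U -> colombeau0 V ->
  exists2 M : R, 0 <= M & \forall eps \near 0^'+, forall s z, (size s <= 2)%N ->
    open_slab T z -> box L (space_of z) ->
    `|partials s (grepr U eps - grepr V eps) z| <= M.
Proof.
move=> U0 V0.
have cK := @cylinder_compact R L d 0 T.
set K := [set z | _] in cK.
have KX : K `<=` X by move=> z [].
have sU := colombeau0_smooth U0; have sV := colombeau0_smooth V0.
have bound1 s : exists C : R, 0 <= C /\ \forall eps \near 0^'+,
    forall z, open_slab T z -> box L (space_of z) ->
    `|partials s (grepr U eps - grepr V eps) z| <= C.
  have [C C0 UC] := colombeau0_bounded s U0 cK KX.
  have [C' C'0 VC] := colombeau0_bounded s V0 cK KX.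
  exists (C + C'); split; first exact: addr_ge0.
  near=> eps; have e01 : 0 < eps <= 1 by near: eps; exact: near_eps01.
  move=> z zT zL; have Kz : K z by split=> //; exact: slab_sub.
  rewrite (partialsB s (sU _ e01) (sV _ e01) zT).
  rewrite -(smooth_ext_inner (sU _ e01) s zT) -(smooth_ext_inner (sV _ e01) s zT).
  apply: le_trans (ler_normB _ _) _; apply: lerD.
    by move: z Kz {zT zL}; near: eps.
  by move: z Kz {zT zL}; near: eps.
have [C /all_and2[C0 CP]] := choice bound1.
(* Lists of length at most 2 are finite in number, so summing their nonnegative bounds gives one
   constant valid for all of them. *)
exists (C [::] + \sum_i C [:: i] + \sum_i \sum_j C [:: i; j]).
  by rewrite !addr_ge0// !sumr_ge0// => i _; exact: sumr_ge0.
have le_bigsum m (F : 'I_m -> R) i : (forall i, 0 <= F i) -> F i <= \sum_i F i.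
  by move=> F0; rewrite (bigD1 i)//= lerDl sumr_ge0.
have CS1 : 0 <= \sum_i C [:: i] by exact: sumr_ge0.
have CS2 : 0 <= \sum_i \sum_j C [:: i; j].
  by apply: sumr_ge0 => i _; exact: sumr_ge0.
have near1 : \forall eps \near 0^'+, forall i z, open_slab T z ->
    box L (space_of z) -> `|partials [:: i] (grepr U eps - grepr V eps) z| <= C [:: i].
  by apply: filter_forall => i; exact: CP.
have near2 : \forall eps \near 0^'+, forall i j z, open_slab T z ->
    box L (space_of z) ->
    `|partials [:: i; j] (grepr U eps - grepr V eps) z| <= C [:: i; j].
  by apply: filter_forall => i; apply: filter_forall => j; exact: CP.
near=> eps => -[|i [|j [|//]]] z _ zT zL.
- apply: (@le_trans _ _ (C [::])); last by rewrite -addrA lerDl addr_ge0.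
  by move: z zT zL; near: eps; exact: CP.
- apply: (@le_trans _ _ (C [:: i])).
    by move: i z zT zL; near: eps.
  have := le_bigsum _ (fun i => C [:: i]) i (fun i => C0 _).
  have := C0 [::]; lra.
- apply: (@le_trans _ _ (C [:: i; j])).
    by move: i j z zT zL; near: eps.
  have := le_bigsum _ (fun j => C [:: i; j]) j (fun j => C0 _).
  have := le_bigsum _ (fun i => \sum_j C [:: i; j]) i
    (fun i => sumr_ge0 _ (fun j _ => C0 _)).
  have := C0 [::]; lra.
Unshelve. all: by end_near. Qed.

Lemma wave_difference_small U V (g : net R (1 + d)) (rho delta : R) :
  colombeau0 U -> colombeau0 V ->
  dalembertian U = gclass X g -> dalembertian V = 0 ->
  initial U = initial V ->
  initial (gpartial (tdir d) U) = initial (gpartial (tdir d) V) ->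
  (forall K (eta : R), compact K -> K `<=` X -> 0 < eta ->
    \forall eps \near 0^'+, forall z, K z -> `|g eps z| <= eta) ->
  0 <= rho -> 0 < delta ->
  \forall eps \near 0^'+, forall t x, 0 <= t <= T -> box rho x ->
    `|grepr U eps (point t x) - grepr V eps (point t x)| <= delta.
Proof.
move=> U0 V0 Ug V_eq UV0 UV1 g_small rho0 delta0.
have sU := colombeau0_smooth U0; have sV := colombeau0_smooth V0.
have [L L0 stab] := wave_stability d T_gt0 rho0.
have [M M0 UVM] := partials_bounded L U0 V0.
have [eta eta0 {}stab] := stab M delta M0 delta0.
(* Thirds for the equation of [U], the equation of [V] and the source [g]. *)
have eta30 : 0 < eta / 3 by exact: divr_gt0.
have cK := @cylinder_compact R L d 0 T.
set K := [set z | _] in cK.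
have KX : K `<=` X by move=> z [].
have hU := dalembertian_grepr sU Ug cK KX eta30.
rewrite -(gclass0 X) in V_eq.
have hV := dalembertian_grepr sV V_eq cK KX eta30.
have hg := g_small K (eta / 3) cK KX eta30.
have h0 := initial_grepr L UV0 eta0.
have h1 := initial_gpartial_grepr L sU sV UV1 eta0.
have tri (a b c a' b' : R) : `|a - b - c| <= eta / 3 ->
    `|a' - b' - 0| <= eta / 3 -> `|c| <= eta / 3 -> `|a - a' - (b - b')| <= eta.
  rewrite !ler_norml => /andP[? ?] /andP[? ?] /andP[? ?].
  by apply/andP; split; lra.
near=> eps; have e01 : 0 < eps <= 1 by near: eps; exact: near_eps01.
apply: (stab (grepr U eps - grepr V eps)).
- by apply: smoothB; [exact: sU | exact: sV].
- by near: eps.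
- move=> z zT zL; have Kz : K z by split=> //; exact: slab_sub.
  have HU : `|partials [:: tdir d; tdir d] (grepr U eps) z -
      \sum_j partials [:: sdir j; sdir j] (grepr U eps) z - g eps z| <= eta / 3.
    by move: z Kz zT {zL}; near: eps.
  have HV : `|partials [:: tdir d; tdir d] (grepr V eps) z -
      \sum_j partials [:: sdir j; sdir j] (grepr V eps) z - 0| <= eta / 3.
    by move: z Kz zT {zL HU}; near: eps.
  have Hg : `|g eps z| <= eta / 3 by move: z Kz {zT zL HU HV}; near: eps.
  rewrite (partialsB _ (sU _ e01) (sV _ e01) zT).
  under eq_bigr do rewrite (partialsB _ (sU _ e01) (sV _ e01) zT).
  rewrite sumrB; exact: tri HU HV Hg.
- by near: eps.
- move=> x xL; rewrite (extB [:: tdir d] (sU _ e01) (sV _ e01)); last first.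
    by rewrite /= /closed_slab /= time_of_point lexx ltW.
  by move: x xL; near: eps.
Unshelve. all: by end_near. Qed.

End WaveRepresentatives.

(** * Association *)

(** The integrals extend over the whole line, but the integrand vanishes off a segment in each
    variable, and [normr_Rintegral_le] sees only that segment. *)
Lemma space_integral_bound (R : realType) (rho C : R) d (g : 'rV[R]_d -> R) :
  0 <= rho -> 0 <= C -> (forall x, box rho x -> `|g x| <= C) ->
  (forall x, ~ box rho x -> g x = 0) ->
  `|space_integral g| <= C * (2 * rho) ^+ d.
Proof.
move=> rho0; elim: d g C => [|d IHd] g C C0 gC g0 /=.
  by rewrite expr0 mulr1; apply: gC => -[].
have -> : C * (2 * rho) ^+ d.+1 = C * (2 * rho) ^+ d *
    fine (@lebesgue_measure R `[(- rho), rho]%classic).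
  by rewrite fine_lebesgue_itvcc ?exprSr ?mulrA; lra.
apply: normr_Rintegral_le => //; first exact: lebesgue_itvcc_fin.
- by apply: mulr_ge0 => //; apply: exprn_ge0; lra.
- move=> s _ s_rho; apply: IHd => // x xrho; first by apply/gC/box_point.
  apply: g0 => sx; apply: xrho => j.
  by have := sx (sdir j); rewrite -[row_mx _ _]/(point s x) point_sdir.
move=> s _ s_rho; have g_eq0 (x : 'rV_d) : g (point s x) = 0.
  apply: g0 => sx; apply: s_rho; rewrite /= in_itv /= -ler_norml.
  by have := sx (tdir d); rewrite -[X in `|X|]/(time_of (point s x)) time_of_point.
(* Off the segment the inner integrand is zero; the induction hypothesis with constant 0 shows that
   its integral vanishes. *)
apply/eqP; rewrite -normr_le0 -[leRHS](mul0r ((2 * rho) ^+ d)).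
by apply: IHd => // x _; rewrite -[row_mx _ _]/(point s x) g_eq0 ?normr0.
Qed.

Lemma compact_coord_bounded (R : realType) n (A : set 'rV[R]_n) : compact A ->
  exists2 rho : R, 0 <= rho & forall z i, A z -> `|z 0 i| <= rho.
Proof.
move=> cA; have bound i : exists C : R, 0 <= C /\ forall z, A z -> `|z 0 i| <= C.
  have /compact_bounded[M [_ MP]] : compact ((fun z : 'rV[R]_n => z 0 i) @` A).
    apply: continuous_compact => //.
    by apply: continuous_subspaceT => z; exact: coord_continuous.
  exists (`|M| + 1); split; first by rewrite addr_ge0.
  move=> z Az; apply: (MP (`|M| + 1)); last by exists z.
  by rewrite (le_lt_trans (ler_norm _))// ltrDl.
have [C /all_and2[C0 CP]] := choice bound.
exists (\sum_i C i) => [|z i Az]; first exact: sumr_ge0.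
by apply: le_trans (CP i z Az) _; rewrite (bigD1 i)//= lerDl sumr_ge0.
Qed.

Lemma valuation_small (R : realType) (E : gen_num R) (delta : R) :
  (0 < valuation E)%E -> 0 < delta ->
  \forall eps \near 0^'+, `|nrepr E eps| <= delta.
Proof.
move=> /ereal_sup_gt[_ [b Eb <-]]; rewrite lte_fin => b0 delta0.
have /eqO_exP[k k0 Ek] := Eb.
(* Solution of [k * c ^ b = delta]; the exponent [b > 0] comes from the positive valuation. *)
pose c := (delta / k) `^ b^-1.
have c0 : 0 < c by rewrite powR_gt0// divr_gt0.
near=> eps; have e0 : 0 < eps by near: eps; exact: nbhs_right_gt.
have ec : eps <= c by near: eps; exact: nbhs_right_le.
apply: (@le_trans _ _ (k * `|eps `^ b|)); first by near: eps; exact: Ek.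
rewrite ger0_norm ?powR_ge0// mulrC -ler_pdivlMr//.
have -> : delta / k = c `^ b.
  by rewrite /c -powRrM mulVf ?gt_eqF// powRr1// ltW// divr_gt0.
by apply: ge0_ler_powR; rewrite ?nnegrE ?ltW.
Unshelve. all: by end_near. Qed.

(** On [K] the values of [u] stay in a fixed segment, where [f] is bounded by [M]. The
    representative chosen for f(U) adds at most 1, and the factor tending to 0 absorbs [M + 1]. *)
Lemma source_small (R : realType) n (X : domain R n) (E : gen_num R) (f : R -> R)
    (U : gen_fun X) (K : set 'rV[R]_n) (eta : R) :
  (0 < valuation E)%E -> continuous f -> colombeau0 U ->
  compact K -> K `<=` X -> 0 < eta ->
  \forall eps \near 0^'+, forall z, K z ->
    `|nrepr E eps * grepr (gcomp f U) eps z| <= eta.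
Proof.
move=> E_val fc U0 cK KX eta0.
have sU := colombeau0_smooth U0.
have [C C0 UC] := colombeau0_bounded [::] U0 cK KX.
have [M M0 fM] : exists2 M : R, 0 <= M & forall y, `|y| <= C -> `|f y| <= M.
  have /compact_bounded[M [_ MP]] : compact (f @` `[(- C), C]).
    by apply: continuous_compact; [exact: continuous_subspaceT | exact: segment_compact].
  exists (`|M| + 1) => [|y yC]; first by rewrite addr_ge0.
  apply: (MP (`|M| + 1)); first by rewrite (le_lt_trans (ler_norm _))// ltrDl.
  by exists y => //; rewrite /= in_itv /= -ler_norml.
have nf : negligible X ((fun eps x => f (grepr U eps x)) - grepr (gcomp f U)).
  exact: grepr_negligible.
have hf := negligible_value_le nf cK KX ltr01.
have M10 : 0 < M + 1 by rewrite ltr_wpDl.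
have hE := valuation_small E_val (divr_gt0 eta0 M10).
have h01 := near_eps01 R.
have hU : \forall eps \near 0^'+, forall z, K z -> `|grepr U eps z| <= C.
  apply: filterS2 h01 UC => eps e01 H z Kz.
  by rewrite -(smooth_ext0 (sU _ e01) (KX _ Kz)); exact: H.
apply: filterS3 hf hE hU => eps Hf HE HU z Kz.
rewrite normrM -[eta](divfK (lt0r_neq0 M10)); apply: ler_pM => //.
have -> : grepr (gcomp f U) eps z = f (grepr U eps z) -
    ((fun eps x => f (grepr U eps x)) - grepr (gcomp f U)) eps z.
  by rewrite /= subKr.
apply: le_trans (ler_normB _ _) _; apply: lerD; last exact: Hf.
exact/fM/HU.
Qed.

(** Association quantifies over all representatives, so a third of the tolerance goes to each change
    of representative. The support of [psi] confines the integral to one box, where uniform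
    smallness suffices. *)
Lemma associated_of_uniform (R : realType) d (T : R) (T_gt0 : 0 < T)
    (U V : gen_fun (slab d T_gt0)) :
  (forall rho delta : R, 0 <= rho -> 0 < delta ->
    \forall eps \near 0^'+, forall t x, 0 <= t <= T -> box rho x ->
    `|grepr U eps (point t x) - grepr V eps (point t x)| <= delta) ->
  associated U V.
Proof.
move=> UV u v uU vV psi spsi cpsi.
have [rho rho0 psi_rho] := compact_coord_bounded cpsi.
have cK := @cylinder_compact R rho d 0 T.
set K := [set z | _] in cK.
have KX : K `<=` slab d T_gt0 by move=> z [].
have [B B0 psiB] : exists2 B : R, 0 < B & forall z, K z -> `|psi z| <= B.
  have [M MP] := ext_has_ubound [::] spsi cK KX.
  exists (`|M| + 1) => [|z Kz]; first by rewrite ltr_wpDl.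
  apply: (@le_trans _ _ M); last first.
    by apply: (le_trans (ler_norm _)); rewrite lerDl.
  by apply: MP; exists z => //; rewrite /= (smooth_ext0 spsi (KX _ Kz)).
have psi0 t x : 0 <= t <= T -> ~ box rho x -> psi (point t x) = 0.
  move=> tT; apply: contra_notP => /eqP psi_neq0 j.
  rewrite -(point_sdir t x j); apply: psi_rho; apply: subset_closure.
  by split=> //; rewrite /closed_slab /= time_of_point.
(* [P - 1] bounds the integral of [|psi|] over the slab; the added 1 keeps [P] positive when
   [rho = 0]. *)
pose P := B * (2 * rho) ^+ d * T + 1.
have P0 : 0 < P.
  by rewrite ltr_wpDl// !mulr_ge0 ?exprn_ge0 ?(ltW B0) ?(ltW T_gt0)// mulr_ge0.
apply/cvgrPdist_le => e e0.
have eP : 0 < e / P by exact: divr_gt0.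
have eP3 : 0 < e / P / 3 by exact: divr_gt0.
have h1 := UV rho (e / P / 3) rho0 eP3.
have h2 := negligible_value_le (grepr_negligible uU) cK KX eP3.
have h3 := negligible_value_le (grepr_negligible vV) cK KX eP3.
apply: filterS3 h1 h2 h3 => eps H1 H2 H3; rewrite sub0r normrN.
have uv t x : 0 <= t <= T -> box rho x ->
    `|u eps (point t x) - v eps (point t x)| <= e / P.
  move=> tT xrho; have Kz : K (point t x).
    by split; rewrite ?time_of_point ?space_of_point.
  move: (H1 t x tT xrho) (H2 _ Kz) (H3 _ Kz).
  have subE (a b : R -> 'rV[R]_(1 + d) -> R) z : (a - b) eps z = a eps z - b eps z.
    by [].
  rewrite !subE.
  move: (grepr _ _ _) (grepr _ _ _) (u _ _) (v _ _) (e / P) => a b a' b' c.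
  by rewrite !ler_norml => /andP[? ?] /andP[? ?] /andP[? ?];
    apply/andP; split; lra.
have : `|\int[@lebesgue_measure R]_(t in `[0, T]) space_integral (fun x : 'rV[R]_d =>
    (u eps (point t x) - v eps (point t x)) * psi (point t x))| <=
    e / P * B * (2 * rho) ^+ d * fine (@lebesgue_measure R `[0, T]%classic).
  apply: normr_Rintegral_le => //; first exact: lebesgue_itvcc_fin.
    by rewrite !mulr_ge0 ?exprn_ge0 ?invr_ge0 ?(ltW B0) ?(ltW e0) ?(ltW P0)// mulr_ge0.
  move=> t; rewrite /= in_itv /= => tT _; apply: space_integral_bound => //.
  - by rewrite mulr_ge0 ?(ltW B0) ?(ltW eP).
  - move=> x xrho; rewrite normrM; apply: ler_pM => //; first exact: uv.
    by apply: psiB; split; rewrite ?time_of_point ?space_of_point.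
  - by move=> x xrho; rewrite psi0// mulr0.
move=> /le_trans; apply; rewrite fine_lebesgue_itvcc ?(ltW T_gt0)// subr0.
have -> : e / P * B * (2 * rho) ^+ d * T = e / P * (P - 1) by rewrite /P; ring.
by rewrite mulrBr mulr1 divfK ?(lt0r_neq0 P0)// lerBlDr lerDl ltW.
Qed.

Theorem proposition3p4 (R : realType) (d : nat) (T : R)
  (d_range : (1 <= d <= 3)%N) (T_gt0 : 0 < T)
  (E : gen_num R) (f : R -> R) (U0 U1 : gen_fun (whole R d)) (r : R)
  (U V : gen_fun (slab d T_gt0))
  (E_num : generalized_number E)
  (E_val : (0 < valuation E)%E)
  (f_smooth : forall (k : nat) (x : R), derivable (derive1n k f) x 1)
  (f0 : f 0 = 0)
  (r_ge0 : 0 <= r)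
  (U0_G0 : colombeau0 U0) (U1_G0 : colombeau0 U1)
  (U0_compact : compact (gsupport U0)) (U1_compact : compact (gsupport U1))
  (U0_supp : gsupport U0 `<=` [set x | enorm x <= r])
  (U1_supp : gsupport U1 `<=` [set x | enorm x <= r])
  (* U solves the nonlinear problem, with support in K_0 *)
  (U_G0 : colombeau0 U)
  (U_supp : gsupport U `<=`
     [set z | closed_slab T z /\ enorm (space_of z) <= time_of z + r])
  (U_eq : dalembertian U = gscale E (gcomp f U))
  (U_init0 : initial U = U0)
  (U_init1 : initial (gpartial (tdir d) U) = U1)
  (* V solves the linear problem *)
  (V_G0 : colombeau0 V)
  (V_eq : dalembertian V = 0)
  (V_init0 : initial V = U0)
  (V_init1 : initial (gpartial (tdir d) V) = U1) :
  associated U V.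
Proof.
have f_cont : continuous f.
  move=> x; apply: differentiable_continuous.
  exact/derivable1_diffP/(f_smooth 0).
apply: associated_of_uniform => rho delta rho0 delta0.
apply: (wave_difference_small U_G0 V_G0 U_eq V_eq _ _ _ rho0 delta0).
- by rewrite U_init0 V_init0.
- by rewrite U_init1 V_init1.
- by move=> K eta cK KX eta0; exact: source_small.
Qed.
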